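(* Let $k$ be an even positive integer. For any $g\in\mathcal S^{\mathrm{new}}(\Gamma_0(4),k,1)$, we have $g|_kW_4=-g$, where $W_4=\begin{pmatrix}0&-1\\4&0\end{pmatrix}$.
   Context: $\mathbb H$ is the upper half plane. For a real matrix $M=\begin{pmatrix}a&b\\c&d\end{pmatrix}$ of positive determinant and a function $f$ on $\mathbb H$, the weight-$k$ slash operator is $(f|_kM)(\tau)=\det(M)^{k/2}(c\tau+d)^{-k}f\left(\frac{a\tau+b}{c\tau+d}\right)$. The operator $|_kW_4$ is the Fricke involution of level $4$. $\Gamma_0(N)$ is the group of matrices in $\mathrm{SL}_2(\mathbb Z)$ with lower-left entry divisible by $N$. $\mathcal S(\Gamma_0(N),k,1)$ is the space of cusp forms of weight $k$ for $\Gamma_0(N)$ with trivial character. $\mathcal S^{\mathrm{new}}(\Gamma_0(N),k,1)\subseteq\mathcal S(\Gamma_0(N),k,1)$ is the usual new subspace (Atkin–Lehner–Li), i.e. the orthogonal complement, under the Petersson inner product, of the span of all $h(d\tau)$ with $h\in\mathcal S(\Gamma_0(M),k,1)$, $M\mid N$, $M\neq N$, $d\mid N/M$. *)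

(* Defs.v *)
From HB Require Import structures.
From mathcomp Require Import all_boot all_order all_algebra.
From mathcomp Require Import all_classical all_reals all_analysis.
From mathcomp Require Import complex.

Set Implicit Arguments.
Unset Strict Implicit.
Unset Printing Implicit Defensive.

Import Order.TTheory GRing.Theory Num.Theory.
Import numFieldNormedType.Exports.

Local Open Scope classical_set_scope.
Local Open Scope ring_scope.
Local Open Scope complex_scope.

(* Functions on the upper half plane are represented by functions
   [f : R[i] -> R[i]]; every definition below looks at the values of [f] on
   [upper_half_plane] only. *)
Definition upper_half_plane (R : realType) : set R[i] :=
  [set tau | 0 < complex.Im tau].
Arguments upper_half_plane {R}.

Definition mx2 (T : Type) (a b c d : T) : 'M[T]_2 :=
  \matrix_(i < 2, j < 2)
    if i == 0 then (if j == 0 then a else b) else (if j == 0 then c else d).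

Definition automorphy_factor (R : realType) (M : 'M[R]_2) (tau : R[i]) : R[i] :=
  (M 1 0)%:C * tau + (M 1 1)%:C.

Definition moebius (R : realType) (M : 'M[R]_2) (tau : R[i]) : R[i] :=
  ((M 0 0)%:C * tau + (M 0 1)%:C) / automorphy_factor M tau.

Definition slash (R : realType) (k : nat) (M : 'M[R]_2) (f : R[i] -> R[i])
    (tau : R[i]) : R[i] :=
  ((\det M) `^ (k%:R / 2))%:C * automorphy_factor M tau ^- k
  * f (moebius M tau).

Definition SL2Z : set 'M[int]_2 := [set g | \det g = 1].

Definition Gamma0 (N : nat) : set 'M[int]_2 :=
  [set g | SL2Z g /\ (N%:Z %| g 1%R 0%R)%Z].

Definition real_mx (R : realType) (g : 'M[int]_2) : 'M[R]_2 :=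
  map_mx (fun z : int => z%:~R) g.

Definition W4 (R : realType) : 'M[R]_2 := mx2 0 (- 1) 4 0.

(* [derivable] over the field [R[i]] is complex differentiability. *)
Definition holomorphic (R : realType) (f : R[i] -> R[i]) : Prop :=
  forall tau : R[i], upper_half_plane tau ->
    derivable (f : R[i]^o -> R[i]^o) tau 1.

Definition cexp (R : realType) (z : R[i]) : R[i] :=
  (expR (complex.Re z))%:C * (cos (complex.Im z) +i* sin (complex.Im z)).

(* q_h(tau) = exp(2 pi i tau / h) *)
Definition nome (R : realType) (h : nat) (tau : R[i]) : R[i] :=
  cexp (2 * (pi : R)%:C * 'i * tau / h%:R).

(* f has a Fourier expansion \sum_(n >= 1) a_n q_h^n on the upper half plane,
   for some positive integer h: f is holomorphic at infinity and its constant
   term is 0. *)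
Definition vanishes_at_infinity (R : realType) (f : R[i] -> R[i]) : Prop :=
  exists2 h : nat, (0 < h)%N & exists2 a : nat -> R[i], a 0%N = 0 &
    forall tau, upper_half_plane tau ->
      series (fun n => a n * nome h tau ^+ n : R[i]^o) @ \oo
        --> (f tau : R[i]^o).

Definition cusp_form (R : realType) (N k : nat) : set (R[i] -> R[i]) :=
  [set f | [/\ holomorphic f,
    (forall g, Gamma0 N g -> forall tau, upper_half_plane tau ->
       slash k (real_mx R g) f tau = f tau) &
    (forall g, SL2Z g -> vanishes_at_infinity (slash k (real_mx R g) f))]].

(* The Ford fundamental domain of Gamma_0(N), in the coordinates
   tau = x + i y: the part of the strip |x| <= 1/2 lying outside all the
   isometric circles |c tau + d| = 1 of elements of Gamma_0(N). (The condition
   is void when c = 0, since then d = 1 or -1.) It meets every orbit of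
   Gamma_0(N), and its interior contains no two distinct points of the same
   orbit; its boundary has measure 0. For N = 1 it is the usual
   |x| <= 1/2, |tau| >= 1. *)
Definition ford_domain (R : realType) (N : nat) : set (R * R) :=
  [set p | [/\ 0 < p.2, `|p.1| <= 1 / 2 &
    forall g, Gamma0 N g ->
      1 <= `|automorphy_factor (real_mx R g) (p.1 +i* p.2)|]].

Definition cintegral (R : realType) (D : set (R * R)) (F : R * R -> R[i])
    : R[i] :=
  let mu := (lebesgue_measure \x lebesgue_measure)%E in
  Rintegral mu D (fun p => complex.Re (F p))
  +i* Rintegral mu D (fun p => complex.Im (F p)).

(* The integral of f(tau) * conj(g(tau)) * y^k dx dy / y^2 over
   Gamma_0(N) \ H; no normalization by the volume. *)
Definition petersson (R : realType) (N k : nat) (f g : R[i] -> R[i]) : R[i] :=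
  cintegral (@ford_domain R N) (fun p =>
    let tau := p.1 +i* p.2 in
    f tau * (g tau)^* * (p.2 ^+ k / p.2 ^+ 2)%:C).

Definition linear_span (R : realType) (S : set (R[i] -> R[i])) :
    set (R[i] -> R[i]) :=
  [set f | exists (n : nat) (c : 'I_n -> R[i]) (s : 'I_n -> R[i] -> R[i]),
     (forall i, S (s i)) /\
     (forall tau, upper_half_plane tau -> f tau = \sum_(i < n) c i * s i tau)].

Definition old_generators (R : realType) (N k : nat) : set (R[i] -> R[i]) :=
  [set f | exists (M d : nat) (h : R[i] -> R[i]),
     [/\ (M %| N)%N, M <> N, (d %| N %/ M)%N, cusp_form M k h &
         f = (fun tau => h (d%:R * tau))]].

Definition old_space (R : realType) (N k : nat) : set (R[i] -> R[i]) :=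
  linear_span (old_generators N k).

Definition new_space (R : realType) (N k : nat) : set (R[i] -> R[i]) :=
  [set f | cusp_form N k f /\
     (forall h, old_space N k h -> petersson N k f h = 0)].

(* Main.v *)
Require Import Defs.
From mathcomp Require Import all_boot all_order all_algebra.
From mathcomp Require Import all_classical all_reals all_analysis.
From mathcomp Require Import measurable_realfun.
From mathcomp Require Import complex ring lra zify.

Set Implicit Arguments.
Unset Strict Implicit.
Unset Printing Implicit Defensive.

Import Order.TTheory GRing.Theory Num.Theory.
Import numFieldNormedType.Exports.

Local Open Scope classical_set_scope.
Local Open Scope ring_scope.
Local Open Scope complex_scope.

(** Write t for the translation by 1/2. A newform g of level 4 is orthogonal to its
    traces to level 2, both directly and after applying the Fricke involution;
    orthogonality forces these traces to vanish, which says that g|t = -g and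
    (g|W_4)|t = -(g|W_4). As (W_4 t)^3 is scalar, applying it to g gives
    g = -g|W_4.

    The vanishing of a trace F = f + f|t with <f, F> = 0 needs no unfolding: the
    Ford domain of Gamma_0(4) consists of two halves exchanged by t, so that
    <f, F> is the integral of |F|^2 y^(k-2) over the left half. Transporting
    the second orthogonality relation by W_4 needs the invariance of the integral
    under tau |-> -1/(4 tau), which preserves the Ford domain; in the coordinates
    (x / y, y) this map only acts by y |-> c / y on each slope. *)

(** * The slash operator *)

(** The Petersson product is an integral over one fixed domain, not over a quotient, so the changes
    of variable at hand are the symmetries of that domain: the exchange of its halves by t, and tau
    |-> -1/(4 tau). Both old forms that are tested come from level 2: h(tau) with h the trace of g,
    and h(2 tau) with h a Fricke image of the trace of g|W_4; a multiple of the latter is g + g|t.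
    The domain touches the real axis at the cusps 0, 1/2 and -1/2, and cutting the integral into
    halves requires integrability there; this is why the cusp condition is turned into bounds near
    each of them. The zero integral of |F|^2 is used to get F = 0 on a vertical ray, and the
    expansion in q spreads this to the half plane. W_4 t has order 3 up to scalars because its trace
    squared equals its determinant: with t scaled to be integral, X = W_4 t satisfies X^2 - 4X + 16
    = 0, so X^3 = -64. Such negative scalars act trivially because k is even. *)

Lemma det_mx2 (T : comNzRingType) (A : 'M[T]_2) :
  \det A = A 0 0 * A 1 1 - A 0 1 * A 1 0.
Proof.
rewrite (expand_det_row _ 0) big_ord_recl big_ord1 /cofactor !det_mx11 !mxE /=.
rewrite (_ : lift 0 0 = 1 :> 'I_2); last exact/val_inj.
rewrite (_ : lift 1 0 = 0 :> 'I_2); last exact/val_inj.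
by rewrite /= addn0 expr0 mul1r expr1 mulN1r mulrN.
Qed.

Lemma mulmx2 (T : pzSemiRingType) (A B : 'M[T]_2) i j :
  (A *m B) i j = A i 0 * B 0 j + A i 1 * B 1 j.
Proof.
rewrite mxE big_ord_recl big_ord1.
by rewrite (_ : lift 0 0 = 1 :> 'I_2)//; exact/val_inj.
Qed.

Lemma matrix2P (T : Type) (A B : 'M[T]_2) : A 0 0 = B 0 0 -> A 0 1 = B 0 1 ->
  A 1 0 = B 1 0 -> A 1 1 = B 1 1 -> A = B.
Proof.
move=> h00 h01 h10 h11; apply/matrixP => i j.
have [->|->] : i = 0 \/ i = 1.
  by case: i => [[|[|//]] ?]; [left|right]; exact/val_inj.
all: have [->|->] : j = 0 \/ j = 1; try by [].
all: by case: j => [[|[|//]] ?]; [left|right]; exact/val_inj.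
Qed.

Section mx2_entries.
Variables (T : Type) (a b c d : T).
Lemma mx2_00 : mx2 a b c d 0 0 = a. Proof. by rewrite mxE. Qed.
Lemma mx2_01 : mx2 a b c d 0 1 = b. Proof. by rewrite mxE. Qed.
Lemma mx2_10 : mx2 a b c d 1 0 = c. Proof. by rewrite mxE. Qed.
Lemma mx2_11 : mx2 a b c d 1 1 = d. Proof. by rewrite mxE. Qed.
Definition mx2E := (mx2_00, mx2_01, mx2_10, mx2_11).
End mx2_entries.

Section upper_half_plane.
Context {R : realType}.
Implicit Types (M N : 'M[R]_2) (tau z w : R[i]) (f : R[i] -> R[i]).
Local Notation Re := complex.Re.
Local Notation Im := complex.Im.

Lemma cReD z w : Re (z + w) = Re z + Re w. Proof. by case: z w => ? ? []. Qed.
Lemma cImD z w : Im (z + w) = Im z + Im w. Proof. by case: z w => ? ? []. Qed.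
Lemma cReM z w : Re (z * w) = Re z * Re w - Im z * Im w.
Proof. by case: z w => ? ? []. Qed.
Lemma cImM z w : Im (z * w) = Re z * Im w + Im z * Re w.
Proof. by case: z w => ? ? []. Qed.
Lemma cReMC (x : R) w : Re (x%:C * w) = x * Re w.
Proof. by rewrite cReM /= mul0r subr0. Qed.
Lemma cImMC (x : R) w : Im (x%:C * w) = x * Im w.
Proof. by rewrite cImM /= mul0r addr0. Qed.

Lemma natrC (n : nat) : (n%:R : R[i]) = (n%:R : R)%:C.
Proof. by rewrite rmorph_nat. Qed.

Lemma natrCV (n : nat) : (n%:R : R[i])^-1 = (n%:R^-1 : R)%:C.
Proof. by rewrite fmorphV /= -natrC. Qed.

Lemma intrC (b : int) : (b%:~R : R[i]) = (b%:~R : R)%:C.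
Proof. by rewrite rmorph_int. Qed.

Lemma complex_eqP z w : Re z = Re w -> Im z = Im w -> z = w.
Proof. by case: z w => ? ? [? ?] /= -> ->. Qed.

Definition sqnorm z : R := Re z ^+ 2 + Im z ^+ 2.

Lemma cImV z : Im z^-1 = - Im z / sqnorm z. Proof. by case: z => x y /=; rewrite mulNr. Qed.
Lemma cReV z : Re z^-1 = Re z / sqnorm z. Proof. by case: z. Qed.

Lemma sqnorm_gt0 z : z != 0 -> 0 < sqnorm z.
Proof.
move=> z0; rewrite lt_neqAle addr_ge0 ?sqr_ge0// andbT eq_sym.
rewrite paddr_eq0 ?sqr_ge0// !sqrf_eq0; apply: contra z0.
by case: z => x y /= /andP[/eqP-> /eqP->].
Qed.

Lemma sqnormM z w : sqnorm (z * w) = sqnorm z * sqnorm w.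
Proof. by rewrite /sqnorm cReM cImM; ring. Qed.

Lemma automorphy_factor_neq0 M tau : \det M != 0 -> upper_half_plane tau ->
  automorphy_factor M tau != 0.
Proof.
rewrite /upper_half_plane/= => dM Ht; apply/eqP => h0.
have := congr1 (@complex.Im R) h0; have := congr1 (@complex.Re R) h0; move: dM.
rewrite /automorphy_factor det_mx2 !cReD !cImD cReMC cImMC /= addr0 => dM.
move=> h1 /eqP; rewrite mulf_eq0 (gt_eqF Ht) orbF => /eqP h2.
by move: h1 dM; rewrite h2 mul0r add0r => ->; rewrite !mulr0 subr0 eqxx.
Qed.

Lemma Im_moebius M tau : automorphy_factor M tau != 0 ->
  Im (moebius M tau) = \det M * Im tau / sqnorm (automorphy_factor M tau).
Proof.
move=> a0; rewrite /moebius cImM cImV cReV.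
have := sqnorm_gt0 a0; rewrite lt0r => /andP[s0 _].
rewrite det_mx2; move: s0; set s := sqnorm _ => s0.
rewrite /automorphy_factor !cReD !cImD !cReMC !cImMC /=; field.
exact: s0.
Qed.

Lemma moebius_uhp M tau : 0 < \det M -> upper_half_plane tau ->
  upper_half_plane (moebius M tau).
Proof.
move=> dM Ht; have a0 := automorphy_factor_neq0 (lt0r_neq0 dM) Ht.
by rewrite /upper_half_plane /= Im_moebius// divr_gt0 ?sqnorm_gt0 ?mulr_gt0.
Qed.

Lemma automorphy_factorM M N tau : automorphy_factor N tau != 0 ->
  automorphy_factor (M *m N) tau =
  automorphy_factor M (moebius N tau) * automorphy_factor N tau.
Proof.
move=> a0; rewrite {2}/automorphy_factor mulrDl -mulrA /moebius divfK//.
rewrite /automorphy_factor !mulmx2 !rmorphD !rmorphM /=; ring.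
Qed.

Lemma moebiusM M N tau : automorphy_factor N tau != 0 ->
  automorphy_factor (M *m N) tau != 0 ->
  moebius (M *m N) tau = moebius M (moebius N tau).
Proof.
move=> a0; rewrite {1 2}/moebius automorphy_factorM// mulf_eq0 negb_or.
move=> /andP[b0 _]; set b := automorphy_factor M _ in b0 *.
set a := automorphy_factor N tau in a0 *.
apply/eqP; rewrite eqr_div ?mulf_neq0// ; apply/eqP.
rewrite (mulrC b a) mulrA; congr (_ * b).
rewrite mulrDl -mulrA /moebius divfK// /a /automorphy_factor.
rewrite !mulmx2 !rmorphD !rmorphM /=; ring.
Qed.

Lemma slash_eq k M f g tau : 0 < \det M ->
  (forall t, upper_half_plane t -> f t = g t) -> upper_half_plane tau ->
  slash k M f tau = slash k M g tau.
Proof. by move=> dM fg Ht; rewrite /slash fg//; exact: moebius_uhp. Qed.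

Lemma slashM k M N f tau : 0 < \det M -> 0 < \det N -> upper_half_plane tau ->
  slash k N (slash k M f) tau = slash k (M *m N) f tau.
Proof.
move=> dM dN Ht; have aN := automorphy_factor_neq0 (lt0r_neq0 dN) Ht.
have aMN : automorphy_factor (M *m N) tau != 0.
  by apply: automorphy_factor_neq0 => //; rewrite det_mulmx mulf_neq0 ?gt_eqF.
rewrite /slash moebiusM// automorphy_factorM// exprMn invfM det_mulmx.
rewrite powRM ?ltW// rmorphM /=; ring.
Qed.

Lemma slashD k M f g tau : slash k M (fun t => f t + g t) tau =
  slash k M f tau + slash k M g tau.
Proof. by rewrite /slash mulrDr. Qed.

Lemma powR_half_even k (x : R) : ~~ odd k -> 0 <= x ->
  x `^ (k%:R / 2) = x ^+ k./2.
Proof.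
move=> ke x0; rewrite -{1}(odd_double_half k) (negbTE ke) add0n.
by rewrite -muln2 natrM mulfK ?pnatr_eq0// powR_mulrn.
Qed.

(** The determinant contributes (s^2)^(k/2), which for even k is s^k whatever the sign of s, and
    this cancels the s^(-k) of the automorphy factor. *)
Lemma slashZ k M (s : R) f tau : ~~ odd k -> s != 0 -> 0 < \det M ->
  slash k (s *: M) f tau = slash k M f tau.
Proof.
move=> ke s0 dM; have sC : s%:C != 0 by rewrite (inj_eq (@complexI R) s 0).
rewrite /slash detZ powR_half_even//; last first.
  by rewrite mulr_ge0 ?(ltW dM)// sqr_ge0.
rewrite powR_half_even ?ltW//.
have -> : automorphy_factor (s *: M) tau = s%:C * automorphy_factor M tau.
  by rewrite /automorphy_factor !mxE !rmorphM /= mulrDr !mulrA.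
have -> : moebius (s *: M) tau = moebius M tau.
  rewrite /moebius; have -> : automorphy_factor (s *: M) tau = s%:C * automorphy_factor M tau.
    by rewrite /automorphy_factor !mxE !rmorphM /= mulrDr !mulrA.
  by rewrite !mxE !rmorphM /= -!mulrA -mulrDr -mulf_div divff// mul1r.
have kE : (k./2 + k./2 = k)%N.
  by rewrite addnn -[RHS](odd_double_half k) (negbTE ke).
rewrite exprMn -exprM mul2n -addnn kE rmorphM rmorphXn /= exprMn invfM.
by rewrite mulrACA divff ?expf_neq0// mul1r.
Qed.

End upper_half_plane.

Lemma det_real_mx (R : realType) (A : 'M[int]_2) :
  \det (real_mx R A) = (\det A)%:~R.
Proof. by rewrite /real_mx det_map_mx. Qed.

Lemma real_mxM (R : realType) (A B : 'M[int]_2) :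
  real_mx R (A *m B) = real_mx R A *m real_mx R B.
Proof. exact: map_mxM. Qed.

Lemma real_mx2 (R : realType) (a b c d : int) :
  real_mx R (mx2 a b c d) = mx2 a%:~R b%:~R c%:~R d%:~R.
Proof. by apply: matrix2P; rewrite !mxE. Qed.

Lemma det_real_mx_gt0 (R : realType) (A : 'M[int]_2) :
  (0 < \det (real_mx R A)) = (0 < \det A).
Proof. by rewrite det_real_mx ltr0z. Qed.

(** * Power series *)

Section modulus.
Context {R : realType}.
Implicit Types (z w : R[i]) (x : R) (u : nat -> R[i]).

Definition cabs z : R := complex.Re `|z|.

Lemma cabsE z : `|z| = (cabs z)%:C. Proof. by rewrite /cabs normc_def. Qed.

Lemma cabs_sqnorm z : cabs z ^+ 2 = sqnorm z.
Proof.
by rewrite /cabs normc_def /= sqr_sqrtr// addr_ge0 ?sqr_ge0.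
Qed.

Lemma cabs_ge0 z : 0 <= cabs z. Proof. by rewrite -ler0c -cabsE. Qed.

Lemma cabsM z w : cabs (z * w) = cabs z * cabs w.
Proof. by apply: (@complexI R); rewrite rmorphM /= -!cabsE normrM. Qed.

Lemma cabsX z n : cabs (z ^+ n) = cabs z ^+ n.
Proof. by apply: (@complexI R); rewrite rmorphXn /= -!cabsE normrX. Qed.

Lemma cabsV z : cabs z^-1 = (cabs z)^-1.
Proof. by apply: (@complexI R); rewrite fmorphV /= -!cabsE normfV. Qed.

Lemma cabsN z : cabs (- z) = cabs z.
Proof. by rewrite /cabs normrN. Qed.

Lemma cabsD z w : cabs (z + w) <= cabs z + cabs w.
Proof. by rewrite -lecR rmorphD /= -!cabsE ler_normD. Qed.

Lemma cabs_distrC z w : cabs (z - w) = cabs (w - z).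
Proof. by rewrite -cabsN opprB. Qed.

Lemma cabs_eq0 z : (cabs z == 0) = (z == 0).
Proof. by rewrite -[RHS]normr_eq0 cabsE (inj_eq (@complexI R) _ 0). Qed.

Lemma cabs0 : cabs 0 = 0. Proof. by apply/eqP; rewrite cabs_eq0. Qed.

Lemma cabs_gt0 z : (0 < cabs z) = (z != 0).
Proof. by rewrite lt0r cabs_ge0 andbT cabs_eq0. Qed.

Lemma cabs_real x : 0 <= x -> cabs x%:C = x.
Proof. by move=> x0; rewrite /cabs ger0_norm// ler0c. Qed.

Lemma cabs_Re_Im z : cabs z <= `|complex.Re z| + `|complex.Im z|.
Proof.
rewrite -(@ler_pXn2r _ 2)// ?nnegrE ?cabs_ge0 ?addr_ge0//.
rewrite cabs_sqnorm sqrrD !real_normK ?num_real// /sqnorm lerD2r lerDl.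
by rewrite mulrn_wge0// mulr_ge0.
Qed.

Lemma normr_Re z : `|complex.Re z| <= cabs z.
Proof. by rewrite -lecR -cabsE normc_ge_Re. Qed.

Lemma normr_Im z : `|complex.Im z| <= cabs z.
Proof.
rewrite -(@ler_pXn2r _ 2)// ?nnegrE ?cabs_ge0//.
by rewrite cabs_sqnorm real_normK ?num_real// lerDr sqr_ge0.
Qed.

Lemma cvg_cabsP u (l : R[i]) : ((u : nat -> R[i]^o) @ \oo --> (l : R[i]^o)) <->
  (forall e, 0 < e -> exists N, forall n, (N <= n)%N -> cabs (l - u n) < e).
Proof.
split=> [ul e e0|ul].
  have [N _ uN] : \forall n \near \oo, `|(l : R[i]^o) - u n| < e%:C.
    by move/cvgrPdist_lt : ul; apply; rewrite ltcR.
  by exists N => n Nn; have := uN _ Nn; rewrite /= cabsE ltcR.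
apply/cvgrPdist_lt => e; rewrite ltcE /= => /andP[/eqP eI e0].
have [N uN] := ul _ e0; exists N => // n /= /uN.
by rewrite cabsE ltcE /= eI eqxx.
Qed.

Lemma cvg_cabs_le u (l : R[i]) (z : R[i]) C N :
  (u : nat -> R[i]^o) @ \oo --> (l : R[i]^o) ->
  (forall n, (N <= n)%N -> cabs (u n - z) <= C) -> cabs (l - z) <= C.
Proof.
move=> /cvg_cabsP ul uC; apply/ler_addgt0Pl => e /ul[N' uN'].
have := uN' (maxn N N') (leq_maxr _ _); have := uC (maxn N N') (leq_maxl _ _).
move=> h1 /ltW h2; rewrite -(subrKA (u (maxn N N'))).
exact: le_trans (cabsD _ _) (lerD h2 h1).
Qed.

End modulus.

Section power_series.
Context {R : realType}.
Implicit Types (a : nat -> R[i]) (q l : R[i]).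
Let sums a q := series (fun n => a n * q ^+ n : R[i]^o).

(** A term is a difference of two consecutive partial sums: beyond [N] both are within 1 of the
    limit, and the finitely many earlier terms are bounded by their sum [S]. *)
Lemma power_series_terms_bounded a q l :
  sums a q @ \oo --> (l : R[i]^o) ->
  exists2 C, 0 <= C & forall n, cabs (a n) * cabs q ^+ n <= C.
Proof.
move=> /cvg_cabsP/(_ 1 ltr01)[N hN].
pose S := \sum_(i < N) cabs (a i) * cabs q ^+ i.
have S0 : 0 <= S by apply: sumr_ge0 => i _; rewrite mulr_ge0 ?exprn_ge0 ?cabs_ge0.
exists (2 + S) => [|n]; first by rewrite addr_ge0.
have [nN|Nn] := ltnP n N.
  apply: (@le_trans _ _ S); last by rewrite lerDr.
  rewrite /S (bigD1 (Ordinal nN))//= lerDl sumr_ge0// => i _.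
  by rewrite mulr_ge0 ?exprn_ge0 ?cabs_ge0.
apply: (@le_trans _ _ 2); last by rewrite lerDl.
rewrite -cabsX -cabsM.
have -> : a n * q ^+ n = (l - sums a q n) - (l - sums a q n.+1).
  by rewrite /sums /series /= big_nat_recr//=; ring.
apply: (le_trans (cabsD _ _)); rewrite cabsN -[2]/(1 + 1) lerD//; apply/ltW/hN => //.
exact: leqW.
Qed.

(* The first term dominates the tail, which is bounded by a geometric series
   of ratio t = |q| / r. *)
Lemma power_series_first_term a q l n C (r t : R) :
  sums a q @ \oo --> (l : R[i]^o) -> (forall m, (m < n)%N -> a m = 0) ->
  (forall m, cabs (a m) * r ^+ m <= C) ->
  0 <= t < 1 -> cabs q = t * r -> 
  cabs (l - a n * q ^+ n) * (1 - t) <= C * t ^+ n.+1.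
Proof.
move=> al a0 aC /andP[t0 t1] qt.
have t1' : 0 < 1 - t by rewrite subr_gt0.
have C0 : 0 <= C by apply: le_trans (aC 0%N); rewrite expr0 mulr1 cabs_ge0.
(* The bound on partial sums carries the extra [- t ^+ N], the missing tail of the geometric series,
   so that the induction on [N] closes; it is dropped in the limit. *)
suff partial N : (n < N)%N ->
    cabs (sums a q N - a n * q ^+ n) * (1 - t) <= C * (t ^+ n.+1 - t ^+ N).
  rewrite -ler_pdivlMr//; apply: (@cvg_cabs_le _ _ _ _ _ n.+1 al) => N nN.
  rewrite ler_pdivlMr//; apply: (le_trans (partial _ nN)).
  by rewrite ler_wpM2l// gerBl exprn_ge0.
elim: N => // N IH; rewrite ltnS leq_eqVlt => /predU1P[<-|nN].
  rewrite /sums /series /= big_nat_recr//= big_nat big1 => [|i iN].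
    by rewrite add0r subrr cabs0 mul0r subrr mulr0.
  by rewrite a0 ?mul0r.
have -> : sums a q N.+1 - a n * q ^+ n =
    (sums a q N - a n * q ^+ n) + a N * q ^+ N.
  by rewrite /sums /series /= big_nat_recr//= addrAC.
have step : cabs (a N * q ^+ N) <= C * t ^+ N.
  rewrite cabsM cabsX qt exprMn mulrCA mulrC ler_wpM2r ?exprn_ge0//.
apply: (@le_trans _ _ (C * (t ^+ n.+1 - t ^+ N) + C * t ^+ N * (1 - t))).
  apply: le_trans (_ : (cabs (sums a q N - a n * q ^+ n) +
                        cabs (a N * q ^+ N)) * (1 - t) <= _).
    by rewrite ler_wpM2r ?cabsD// ltW.
  by rewrite mulrDl lerD ?IH// ler_wpM2r// ltW.
rewrite le_eqVlt; apply/orP; left; apply/eqP.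
by rewrite [t ^+ N.+1]exprS; move: (t ^+ n.+1) (t ^+ N) => X Y; ring.
Qed.

Lemma power_series_substitution a q l (c s : R[i]) d : (0 < d)%N ->
  sums a q @ \oo --> (l : R[i]^o) -> q = c * s ^+ d ->
  sums (fun n => if (d %| n)%N then a (n %/ d)%N * c ^+ (n %/ d) else 0) s
    @ \oo --> (l : R[i]^o).
Proof.
(* [up N] is N / d rounded up, the number of multiples of d below N: the N-th partial sum in s
   equals the [up N]-th one in q. *)
move=> d0 al qE; pose up N := ((N + d).-1 %/ d)%N.
have sumsE N : sums (fun n => if (d %| n)%N then a (n %/ d)%N * c ^+ (n %/ d)
    else 0) s N = sums a q (up N).
  elim: N => [|N IH].
    by rewrite /up add0n divn_small ?prednK// /sums /series /= !big_geq.
  transitivity (sums a q (up N) + (if (d %| N)%N then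
      a (N %/ d)%N * q ^+ (N %/ d) else 0)).
    rewrite -IH /sums /series /= big_nat_recr//=; congr (_ + _).
    case: ifPn => [dN|_]; last by rewrite mul0r.
    by rewrite qE exprMn -exprM mulnC divnK// mulrA.
  rewrite /up addSn /= divnDr// divnn d0 addn1.
  case: ifPn => [/dvdnP[m ->]|dN].
    have -> : ((m * d + d).-1 = m * d + d.-1)%N by lia.
    rewrite mulnK// divnMDl// divn_small ?prednK// addn0.
    by rewrite /sums /series /= big_nat_recr.
  have r0 : (0 < N %% d)%N by rewrite lt0n.
  rewrite addr0 (_ : ((N + d).-1 %/ d = (N %/ d).+1)%N)//.
  have := divn_eq N d; have := ltn_pmod N d0; move: r0.
  move: (N %/ d)%N (N %% d)%N => m r r0 rd ->.
  have -> : ((m * d + r + d).-1 = m.+1 * d + r.-1)%N by lia.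
  by rewrite divnMDl// divn_small ?addn0// (leq_ltn_trans (leq_pred _)).
apply/cvg_cabsP => e e0; have [N hN] := (cvg_cabsP _ _).1 al e e0.
exists (N * d)%N => n Nn; rewrite sumsE hN// /up leq_divRL//.
by rewrite (leq_trans Nn)//; lia.
Qed.

End power_series.

(** * Expansions at infinity *)

Section vanishing.
Context {R : realType}.
Implicit Types (f g u : R[i] -> R[i]) (tau z w : R[i]).
Local Notation Re := complex.Re.
Local Notation Im := complex.Im.

Lemma cexpD z w : cexp (z + w) = cexp z * cexp w :> R[i].
Proof.
rewrite /cexp cReD cImD expRD cosD sinD rmorphM /=.
rewrite mulrACA; congr (_ * _); apply: complex_eqP => /=; ring.
Qed.

Lemma cexp0 : cexp 0 = 1 :> R[i].
Proof. by rewrite /cexp /= expR0 cos0 sin0 mul1r. Qed.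

Lemma cexpMn z n : cexp (z *+ n) = cexp z ^+ n.
Proof.
elim: n => [|n IH]; first by rewrite mulr0n cexp0.
by rewrite mulrS cexpD IH exprS.
Qed.

Lemma cabs_cexp z : cabs (cexp z) = expR (Re z).
Proof.
rewrite /cexp cabsM cabs_real ?expR_ge0// -[RHS]mulr1; congr (_ * _).
apply/eqP; rewrite -(@eqrXn2 _ 2)// ?cabs_ge0//.
by rewrite cabs_sqnorm /sqnorm /= cos2Dsin2 expr1n.
Qed.

Lemma cabs_nome h tau :
  cabs (nome h tau) = expR (- (2 * pi / h%:R * Im tau)).
Proof.
rewrite /nome cabs_cexp; congr expR.
have -> : 2 * (pi : R)%:C * 'i * tau / h%:R = (2 * pi / h%:R)%:C * ('i * tau).
  by rewrite !rmorphM fmorphV !rmorph_nat /=; ring.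
by rewrite cReMC cReM /=; ring.
Qed.

Lemma vanishes_eq f g : (forall t, upper_half_plane t -> f t = g t) ->
  vanishes_at_infinity f -> vanishes_at_infinity g.
Proof.
move=> fg [h h0 [a a0 fa]]; exists h; first exact: h0.
by exists a; [exact: a0|move=> t Ht; rewrite -fg//; exact: fa].
Qed.

(** The parameter q_h at (a t + b) / d is [zeta] times the a-th power of q_(h d) at t, with the root
    of unity [zeta] absorbing b; the series is therefore spread over the multiples of a. *)
Lemma vanishes_affine f (a d : nat) (b : int) : (0 < a)%N -> (0 < d)%N ->
  vanishes_at_infinity f ->
  vanishes_at_infinity (fun t => f ((a%:R * t + b%:~R) / d%:R)).
Proof.
move=> a0 d0 [h h0 [c c0 fc]].
exists (h * d)%N; first by rewrite muln_gt0 h0.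
pose zeta : R[i] := cexp (2 * (pi : R)%:C * 'i * b%:~R / (h * d)%:R).
exists (fun n => if (a %| n)%N then c (n %/ a)%N * zeta ^+ (n %/ a) else 0).
  by rewrite dvdn0 div0n c0 mul0r.
move=> t Ht; apply: (power_series_substitution a0 (fc _ _)).
  rewrite /upper_half_plane /= mulrC natrCV cImMC mulr_gt0 ?invr_gt0 ?ltr0n//.
  by rewrite cImD natrC cImMC intrC /= addr0 mulr_gt0 ?ltr0n.
rewrite /zeta /nome -cexpMn -cexpD; congr cexp.
rewrite -mulr_natl natrM.
have h0C : (h%:R : R[i]) != 0 by rewrite pnatr_eq0 -lt0n.
have d0C : (d%:R : R[i]) != 0 by rewrite pnatr_eq0 -lt0n.
by field; rewrite h0C d0C.
Qed.

Lemma vanishesZ f (c : R[i]) : vanishes_at_infinity f ->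
  vanishes_at_infinity (fun t => c * f t).
Proof.
move=> [h h0 [a a0 fa]]; exists h => //.
exists (fun n => c * a n) => [|t /fa ft]; first by rewrite a0 mulr0.
rewrite (_ : series _ = (fun n => (c : R[i]^o) *: series (fun n => a n * nome h t ^+ n : R[i]^o) n)).
  exact: cvgZr.
apply/funext => n; rewrite /series /= scaler_sumr.
by apply: eq_bigr => i _; rewrite -mulrA.
Qed.

Lemma vanishesD f g : vanishes_at_infinity f -> vanishes_at_infinity g ->
  vanishes_at_infinity (fun t => f t + g t).
Proof.
move=> [h h0 [a a0 fa]] [j j0 [b b0 gb]].
exists (h * j)%N; first by rewrite muln_gt0 h0.
(* Both expansions are rewritten in the common parameter q_(h j). The powers of 1 match the shape of
   [power_series_substitution] for the constant 1. *)
pose spread (c : nat -> R[i]) d n : R[i] :=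
  if (d %| n)%N then c (n %/ d)%N * 1 ^+ (n %/ d) else 0.
have nomeM m n t : (0 < m)%N -> (0 < n)%N -> nome n t = 1 * nome (n * m) t ^+ m :> R[i].
  move=> m0 n0; rewrite mul1r /nome -cexpMn; congr cexp.
  rewrite -mulr_natl natrM.
  have m0C : (m%:R : R[i]) != 0 by rewrite pnatr_eq0 -lt0n.
  have n0C : (n%:R : R[i]) != 0 by rewrite pnatr_eq0 -lt0n.
  by field; rewrite m0C n0C.
exists (fun n => spread a j n + spread b h n).
  by rewrite /spread !dvdn0 !div0n a0 b0 !mul0r addr0.
move=> t Ht.
have fj := power_series_substitution j0 (fa t Ht) (nomeM _ _ _ j0 h0).
have gh := power_series_substitution h0 (gb t Ht) (nomeM _ _ _ h0 j0).
rewrite (mulnC j) in gh; apply: cvg_trans (cvgD fj gh).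
apply: near_eq_cvg; near=> n.
rewrite !fctE /series /= -big_split /=.
by apply: eq_bigr => i _; rewrite mulrDl.
Unshelve. all: by end_near.
Qed.

(** Since the constant term is 0, f decays exponentially, which beats any power of Im tau. Comparing
    with the height y0 / 2 keeps the ratio [s] below a fixed [rho] < 1, and makes [s] at most exp(-
    c Im tau), for all Im tau >= y0. *)
Lemma vanishes_bounded f (y0 : R) m : 0 < y0 -> vanishes_at_infinity f ->
  exists2 C, 0 <= C &
    forall tau, y0 <= Im tau -> cabs (f tau) * Im tau ^+ m <= C.
Proof.
move=> y00 [h h0 [a a0 fa]].
have h0R : 0 < (h%:R : R) by rewrite ltr0n.
pose c : R := pi / h%:R; have c0 : 0 < c by rewrite divr_gt0 ?pi_gt0.
pose z0 : R[i] := 0 +i* (y0 / 2).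
have Hz0 : upper_half_plane z0 by rewrite /upper_half_plane /= divr_gt0.
have [C C0 aC] := power_series_terms_bounded (fa _ Hz0).
have ez : 0 < c * y0 by rewrite mulr_gt0.
pose rho := expR (- (c * y0)).
have rho1 : rho < 1 by rewrite -expR0 ltr_expR oppr_lt0.
(* With z = c Im t / (m + 1) one has Im t = K z and z^m <= exp(m z) <= exp(c Im t). Dividing by m +
   1 instead of m covers m = 0. *)
pose K := m.+1%:R / c; have K0 : 0 <= K by rewrite divr_ge0// ltW.
exists (C / (1 - rho) * K ^+ m).
  by apply: mulr_ge0; rewrite ?exprn_ge0// divr_ge0// subr_ge0 ltW.
move=> t yt; have t0 : 0 < Im t by apply: lt_le_trans yt.
pose s := expR (- (2 * c * (Im t - y0 / 2))).
have cyt := ler_wpM2l (ltW c0) yt.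
have s_rho : s <= rho by rewrite ler_expR lerN2; lra.
have sE : s <= expR (- (c * Im t)) by rewrite ler_expR lerN2; lra.
have a_lt0 m' : (m' < 0)%N -> a m' = 0 by [].
have q_s : cabs (nome h t) = s * cabs (nome h z0).
  by rewrite !cabs_nome -expRD; congr expR; rewrite /c /=; field; rewrite gt_eqF.
have s01 : 0 <= s < 1 by rewrite expR_ge0 (le_lt_trans s_rho rho1).
have H := power_series_first_term (fa t t0) a_lt0 aC s01 q_s.
rewrite a0 mul0r subr0 expr1 in H.
have {H}fC : cabs (f t) <= C / (1 - rho) * expR (- (c * Im t)).
  rewrite mulrAC ler_pdivlMr ?subr_gt0//; apply: (@le_trans _ _ (cabs (f t) * (1 - s))).
    by rewrite ler_wpM2l ?cabs_ge0// lerD2l lerN2.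
  by rewrite (le_trans H)// ler_wpM2l.
apply: (le_trans (ler_wpM2r (exprn_ge0 _ (ltW t0)) fC)).
rewrite -[leLHS]mulrA; apply: ler_wpM2l.
  by rewrite divr_ge0 ?subr_ge0 ?(ltW rho1).
rewrite expRN mulrC ler_pdivrMr ?expR_gt0//.
rewrite [X in X ^+ m](_ : Im t = K * (c * Im t / m.+1%:R)); last first.
  rewrite /K; have : (m.+1%:R : R) != 0 by rewrite pnatr_eq0.
  by move: (m.+1%:R : R) => n n0; field; rewrite n0 gt_eqF.
rewrite exprMn ler_wpM2l ?exprn_ge0//.
set z := c * Im t / _.
have z0' : 0 <= z by rewrite /z divr_ge0// mulr_ge0// ltW.
apply: (@le_trans _ _ (expR z ^+ m)).
  rewrite lerXn2r ?nnegrE ?expR_ge0//.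
  by rewrite (le_trans _ (expR_ge1Dx _))// lerDr.
rewrite -expRM_natr ler_expR /z.
rewrite -[leLHS]mulrA; apply: ler_piMr; first by apply: mulr_ge0; apply: ltW.
by rewrite mulrC ler_pdivrMr ?ltr0n// mul1r ler_nat.
Qed.

(** If some coefficient were nonzero, the first such term would dominate the rest of the series high
    enough on the ray, so f could not vanish there. *)
Lemma vanishes_ray_eq0 f (x0 y1 : R) : vanishes_at_infinity f ->
  (forall y, 0 < y -> y1 <= y -> f (x0 +i* y) = 0) ->
  forall tau, upper_half_plane tau -> f tau = 0.
Proof.
move=> [h h0 [a a0 fa]] f0.
have h0R : 0 < (h%:R : R) by rewrite ltr0n.
pose c : R := 2 * pi / h%:R; have c0 : 0 < c by rewrite divr_gt0 ?mulr_gt0 ?pi_gt0.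
pose z0 : R[i] := 0 +i* 1.
have Hz0 : upper_half_plane z0 by rewrite /upper_half_plane /= ltr01.
have [C C0 aC] := power_series_terms_bounded (fa _ Hz0).
pose r := cabs (nome h z0); have r0 : 0 < r by rewrite /r cabs_nome expR_gt0.
suff an0 n : a n = 0.
  move=> t Ht; have := cvg_cabs_le (z := 0) (C := 0) (N := 0) (fa t Ht).
  rewrite subr0 => /(_ _)/wrap[n _|].
    by rewrite /series /= big1 ?subr0 ?cabs0// => i _; rewrite an0 mul0r.
  by move=> h1; apply/eqP; rewrite -cabs_eq0 eq_le h1 cabs_ge0.
elim/ltn_ind: n => n IH; apply/eqP; rewrite -cabs_eq0 eq_le cabs_ge0 andbT.
rewrite leNgt; apply/negP => an_gt0.
pose A := cabs (a n) * r ^+ n; have A0 : 0 < A by rewrite mulr_gt0 ?exprn_gt0.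
(* The first-term estimate will give A <= t (A + C). This [D], together with t (1 + D) <= 1, gives t
   (2 A + C) <= A, hence the contradiction t A <= 0. The height y below is chosen so that c (y - 1)
   >= D. *)
pose D := (A + C) / A; have D0 : 0 < D by apply: divr_gt0 => //; lra.
pose y := 1 + `|y1| + D / c.
have Dc0 : 0 < D / c by exact: divr_gt0.
have y0 : 0 < y by have := normr_ge0 y1; rewrite /y; lra.
have yy1 : y1 <= y by have := ler_norm y1; rewrite /y; lra.
pose t := expR (- (c * (y - 1))).
have tD : t * (1 + D) <= 1.
  rewrite /t expRN mulrC ler_pdivrMr ?expR_gt0// mul1r.
  apply: le_trans (expR_ge1Dx _); rewrite lerD2l /y.
  have -> : 1 + `|y1| + D / c - 1 = `|y1| + D / c by ring.
  rewrite mulrDr [c * (D / c)]mulrC divfK ?gt_eqF// lerDr mulr_ge0//.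
  exact: ltW.
have t0 : 0 < t by exact: expR_gt0.
have t1 : t < 1 by have := mulr_gt0 t0 D0; lra.
have qt : cabs (nome h (x0 +i* y)) = t * r.
  by rewrite /r /t !cabs_nome -expRD; congr expR; rewrite -/c /z0 /=; ring.
have Hy : upper_half_plane (x0 +i* y) by [].
have := power_series_first_term (fa _ Hy) IH aC (t := t).
rewrite f0// sub0r cabsN cabsM cabsX qt exprMn ltW//= t1 => /(_ erefl erefl).
rewrite mulrCA -/A exprSr (mulrCA C) -!(mulrA (t ^+ n)) ler_pM2l ?exprn_gt0//.
have AD : A * D = A + C by rewrite /D mulrC divfK ?gt_eqF.
move=> h1; have := ler_wpM2l (ltW A0) tD.
have -> : A * (t * (1 + D)) = t * (A + A * D) by ring.
rewrite AD mulr1; move: h1 => h1 h2.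
have := mulr_gt0 A0 t0; lra.
Qed.

End vanishing.

(** * Cusp forms of levels 2 and 4 *)

(** Serves to separate the slash by an integral matrix into a part in SL_2(Z), where the cusp
    condition applies, and an affine substitution fixing the cusp at infinity. *)
Lemma hermite_normal_form (B : 'M[int]_2) : 0 < \det B ->
  exists g : 'M[int]_2, exists a d : nat, exists b : int,
    [/\ SL2Z g, (0 < a)%N, (0 < d)%N & B = g *m mx2 a%:Z b 0 d%:Z].
Proof.
rewrite det_mx2; set p := B 0 0; set q := B 0 1; set r := B 1 0; set s := B 1 1.
move=> dB; have [u [v uv]] := Bezoutz p r.
have e0 : gcdz p r != 0.
  by rewrite gcdz_eq0; apply: contraTN dB => /andP[/eqP-> /eqP->]; rewrite mul0r mulr0.
have /dvdzP[p' pE] := dvdz_gcdl p r; have /dvdzP[r' rE] := dvdz_gcdr p r.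
have egt0 : 0 < gcdz p r by rewrite lt0r e0.
set e := gcdz p r in uv e0 pE rE egt0.
have uv1 : u * p' + v * r' = 1.
  by apply: (mulIf e0); rewrite mulrDl -!mulrA -pE -rE uv mul1r.
have d0 : 0 < p' * s - r' * q.
  rewrite -(pmulr_rgt0 _ egt0); suff -> : e * (p' * s - r' * q) = p * s - q * r by [].
  by rewrite pE rE; ring.
set D := _ - _ in d0; exists (mx2 p' (- v) r' u), `|e|%N, `|D|%N, (u * q + v * s).
(* The first column of the unimodular factor is that of B divided by its gcd, completed to
   determinant 1 by the Bezout coefficients; b and d are the image of the second column of B under
   its inverse. *)
rewrite !absz_gt0 e0 gt_eqF// !gtz0_abs//; split=> //; rewrite ?/D.
  by rewrite /SL2Z /= det_mx2 !mx2E -uv1; ring.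
have qs : q = (u * p' + v * r') * q /\ s = (u * p' + v * r') * s.
  by rewrite uv1 !mul1r.
apply: matrix2P; rewrite mulmx2 !mx2E -/p -/q -/r -/s ?mulr0 ?addr0 //.
  by rewrite {1}qs.1; ring.
by rewrite {1}qs.2; ring.
Qed.

Section slash_stability.
Context {R : realType}.
Implicit Types (f u : R[i] -> R[i]) (k : nat).

Lemma holomorphicD f u : holomorphic f -> holomorphic u ->
  holomorphic (fun t => f t + u t).
Proof. by move=> hf hu t Ht; apply: derivableD; [exact: hf|exact: hu]. Qed.

Lemma holomorphic_slash k (M : 'M[R]_2) f : 0 < \det M -> holomorphic f ->
  holomorphic (slash k M f).
Proof.
move=> dM hf t Ht; have a0 := automorphy_factor_neq0 (lt0r_neq0 dM) Ht.
have daff (c d : R[i]) : differentiable (fun z : R[i]^o => (c * z + d : R[i]^o)) (t : R[i]^o).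
  apply: (@differentiableD _ _ _ (c *: (id : R[i]^o -> R[i]^o)) (cst (d : R[i]^o))) => //.
have da : differentiable (automorphy_factor M : R[i]^o -> R[i]^o) (t : R[i]^o) by exact: daff.
have dV : differentiable (fun z : R[i]^o => (automorphy_factor M z)^-1 : R[i]^o) (t : R[i]^o).
  exact: (differentiableV da).
have dm : differentiable (moebius M : R[i]^o -> R[i]^o) (t : R[i]^o).
  apply: (@differentiableM _ _ (fun z : R[i]^o => ((M 0 0)%:C * z + (M 0 1)%:C : R[i]^o)) _ (t : R[i]^o)).
    exact: daff.
  exact: dV.
have df : differentiable (f : R[i]^o -> R[i]^o) (moebius M t : R[i]^o).
  by apply/derivable1_diffP/hf; exact: moebius_uhp.
pose inv : R[i]^o -> R[i]^o := fun z => (automorphy_factor M z)^-1.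
pose C : R[i]^o := ((\det M) `^ (k%:R / 2))%:C.
have dC : differentiable (C *: (inv ^+ k : R[i]^o -> R[i]^o)) (t : R[i]^o).
  apply: differentiableZ; case: (k) => [|n]; last exact: (differentiableX _ dV).
  by rewrite expr0; exact: (differentiable_cst (1 : R[i]^o)).
have -> : (slash k M f : R[i]^o -> R[i]^o) =
    (C *: (inv ^+ k : R[i]^o -> R[i]^o)) * ((f : R[i]^o -> R[i]^o) \o moebius M).
  apply/funext => z; rewrite /slash !fctE; congr (_ * _ * _).
  by rewrite -exprVn; elim: (k) => // n IH; rewrite !exprS fctE IH.
apply/derivable1_diffP; exact: (differentiableM dC (differentiable_comp dm df)).
Qed.

(** The level-free clause of [cusp_form], isolated because it survives the slash by any integral
    matrix of positive determinant, whatever becomes of the level. *)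
Definition cuspidal k u := forall g, SL2Z g ->
  vanishes_at_infinity (slash k (real_mx R g) u).

Lemma cuspidalD k f u : cuspidal k f -> cuspidal k u ->
  cuspidal k (fun t => f t + u t).
Proof.
move=> cf cu g hg; apply: vanishes_eq (vanishesD (cf g hg) (cu g hg)) => t _.
by rewrite slashD.
Qed.

(** Writing B g = al T in Hermite form, the cusp condition for u at al gives an expansion, and
    slashing by the triangular T only substitutes (a t + b) / d and multiplies by a constant. *)
Lemma cuspidal_slash k (B : 'M[int]_2) u : 0 < \det B -> cuspidal k u ->
  cuspidal k (slash k (real_mx R B) u).
Proof.
move=> dB cu g hg; have dg : 0 < \det g by rewrite hg.
have dBg : 0 < \det (B *m g) by rewrite det_mulmx mulr_gt0.
have [al [a [d [b [hal a0 d0 BE]]]]] := hermite_normal_form dBg.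
have dal : 0 < \det al by rewrite hal.
have dT : 0 < \det (mx2 a%:Z b 0 d%:Z).
  by rewrite det_mx2 !mx2E mulr0 subr0 mulr_gt0 ?ltz_nat.
set T := mx2 _ _ _ _ in BE dT.
pose c : R[i] := ((\det (real_mx R T)) `^ (k%:R / 2))%:C * (d%:R ^- k).
apply: (@vanishes_eq _ (fun t => c * slash k (real_mx R al) u ((a%:R * t + b%:~R) / d%:R))).
  move=> t Ht; rewrite [RHS]slashM ?det_real_mx_gt0// -real_mxM BE real_mxM.
  rewrite -[RHS]slashM ?det_real_mx_gt0//.
  move: (slash k (real_mx R al) u) => v; rewrite /slash /c real_mx2.
  have aE : automorphy_factor (mx2 a%:~R b%:~R 0%:~R d%:~R) t = d%:R :> R[i].
    by rewrite /automorphy_factor !mx2E mul0r add0r natrC.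
  by rewrite /moebius aE !mx2E -natrC intrC.
exact/vanishesZ/vanishes_affine/cu.
Qed.

End slash_stability.

Lemma int_parity (z : int) : exists m, z = 2 * m \/ z = 2 * m + 1.
Proof.
have := divz_eq z 2; have := modz_ge0 z (isT : 2 != 0 :> int).
have := ltz_pmod z (isT : 0 < 2 :> int).
move: (z %/ 2)%Z (z %% 2)%Z => m r r2 r0 E; exists m.
have [r00|r01] : r = 0 \/ r = 1 by lia.
  by left; lia.
by right; lia.
Qed.

Lemma odd_factors (a d m : int) : a * d - 2 * m = 1 ->
  exists a' d', a = 2 * a' + 1 /\ d = 2 * d' + 1.
Proof.
have [a' [->|->]] := int_parity a; have [d' [->|->]] := int_parity d; try lia.
by exists a', d'.
Qed.

Section level.
Context {R : realType}.
Implicit Types (f u : R[i] -> R[i]) (N k : nat).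

Lemma cusp_form_slash N k (A : 'M[int]_2) f tau : cusp_form N k f ->
  Gamma0 N A -> upper_half_plane tau -> slash k (real_mx R A) f tau = f tau.
Proof. by move=> [_ inv _] hA Ht; exact: inv. Qed.

Definition fricke N : 'M[int]_2 := mx2 0 (- 1) N%:Z 0.

Lemma det_fricke N : \det (fricke N) = N%:Z.
Proof. by rewrite det_mx2 !mx2E mul0r sub0r mulN1r opprK. Qed.

Lemma cusp_form_fricke N k f : (0 < N)%N -> cusp_form N k f ->
  cusp_form N k (slash k (real_mx R (fricke N)) f).
Proof.
move=> N0 cf; have [hol inv cusp] := cf.
have dW : 0 < \det (real_mx R (fricke N)) by rewrite det_real_mx_gt0 det_fricke ltz_nat.
split; first exact: holomorphic_slash.
  move=> g [hg /dvdzP[c cE]] t Ht.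
  have dg : 0 < \det (real_mx R g) by rewrite det_real_mx_gt0 hg.
  (* The conjugate W_N g W_N^(-1): the Fricke matrix normalizes Gamma_0(N). *)
  pose g' := mx2 (g 1 1) (- c) (- (g 0 1 * N%:Z)) (g 0 0).
  have hg' : Gamma0 N g'.
    split; last by rewrite mx2E; apply/dvdzP; exists (- g 0 1); rewrite mulNr.
    move: hg; rewrite /SL2Z /= !det_mx2 !mx2E cE => <-; ring.
  have dg' : 0 < \det (real_mx R g') by rewrite det_real_mx_gt0 hg'.1.
  rewrite slashM// -real_mxM (_ : fricke N *m g = g' *m fricke N).
    rewrite real_mxM -slashM//; apply: slash_eq => // s Hs.
    exact: cusp_form_slash hg' Hs.
  apply: matrix2P; rewrite !mulmx2 !mx2E ?cE; ring.
by apply: cuspidal_slash; rewrite ?det_fricke ?ltz_nat.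
Qed.

(** The conjugate by W_4 of the translation by 1/2. The sign of -2 makes it this translation and not
    its inverse. *)
Definition trace_rep : 'M[int]_2 := mx2 1 0 (- 2) 1.

Lemma det_trace_rep : \det trace_rep = 1.
Proof. by rewrite det_mx2 !mx2E mul0r subr0 mulr1. Qed.

(* [1] and [trace_rep] represent the two cosets of Gamma0(4) in Gamma0(2). *)
Lemma cusp_form_trace k f : cusp_form 4 k f ->
  cusp_form 2 k (fun t => f t + slash k (real_mx R trace_rep) f t).
Proof.
move=> cf; have [hol inv cusp] := cf.
have dr : 0 < \det (real_mx R trace_rep) by rewrite det_real_mx_gt0 det_trace_rep.
split.
- by apply: holomorphicD; [exact: hol|exact: holomorphic_slash].
- move=> g [hg /dvdzP[c cE]] t Ht.
  have dg : 0 < \det (real_mx R g) by rewrite det_real_mx_gt0 hg.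
  have dgE : g 0 0 * g 1 1 - g 0 1 * (c * 2) = 1 by rewrite -cE -det_mx2.
  pose rV := mx2 1 0 2 1 : 'M[int]_2.
  have drV : \det rV = 1 by rewrite det_mx2 !mx2E mul0r subr0 mulr1.
  have rVr : rV *m trace_rep = 1%:M.
    by apply: matrix2P; rewrite mulmx2 !mx2E !mxE.
  rewrite slashD slashM// -real_mxM.
  have via A B : \det A = 1 -> Gamma0 4 A -> B = A *m trace_rep ->
      slash k (real_mx R B) f t = slash k (real_mx R trace_rep) f t.
    move=> dA hA ->; rewrite real_mxM -slashM ?det_real_mx_gt0 ?dA ?det_trace_rep//.
    by apply: slash_eq => // s Hs; exact: cusp_form_slash hA Hs.
  have [a' [d' [aE dE]]] : exists a' d', g 0 0 = 2 * a' + 1 /\ g 1 1 = 2 * d' + 1.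
    by apply: (@odd_factors _ _ (g 0 1 * c)); rewrite -[RHS]dgE; ring.
  (* The lower-left entry of g is 2 c. For c even, g lies in Gamma_0(4) and right multiplication by
     g fixes both cosets; for c odd it exchanges them, and so the two summands of the trace. *)
  have [c' [c'E|c'E]] := int_parity c.
  + have g4 : Gamma0 4 g by split=> //; apply/dvdzP; exists c'; rewrite cE c'E; ring.
    rewrite (cusp_form_slash cf g4 Ht); congr (_ + _).
    apply: (via (trace_rep *m g *m rV)).
    * by rewrite !det_mulmx hg drV det_trace_rep.
    * split; first by rewrite /SL2Z /= !det_mulmx hg drV det_trace_rep.
      rewrite !mulmx2 !mx2E.
      apply/dvdzP; exists (c' + d' - a' - g 0 1); rewrite cE c'E aE dE; ring.
    * by rewrite -!mulmxA rVr mulmx1.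
  + rewrite addrC; congr (_ + _).
      apply: cusp_form_slash cf _ Ht; split.
        by rewrite /SL2Z /= det_mulmx hg det_trace_rep.
      rewrite mulmx2 !mx2E cE c'E aE.
      by apply/dvdzP; exists (c' - a'); lia.
    apply: (via (g *m rV)).
    * by rewrite det_mulmx hg drV.
    * split; first by rewrite /SL2Z /= det_mulmx hg drV.
      rewrite mulmx2 !mx2E cE c'E dE.
      by apply/dvdzP; exists (c' + d' + 1); lia.
    * by rewrite -mulmxA rVr mulmx1.
- apply: cuspidalD; [exact: cusp|apply: cuspidal_slash; last exact: cusp].
  by rewrite det_trace_rep.
Qed.

End level.

(** * Change of variables in the plane *)

Section plane_measure.
Context {R : realType}.
Notation mu := (@lebesgue_measure R).
Notation plane := (measurableTypeR R * measurableTypeR R)%type.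

(** An open set is the union of the countably many boxes with rational endpoints that it
    contains. *)
Lemma open_measurable_plane (U : set (R * R)) : open U ->
  measurable (U : set plane).
Proof.
move=> oU; pose box (q : rat * rat * (rat * rat)) : set (R * R) :=
  `]ratr q.1.1, ratr q.1.2[%classic `*` `]ratr q.2.1, ratr q.2.2[%classic.
pose F q : set plane := if `[< box q `<=` U >] then box q else set0.
rewrite (_ : U = \bigcup_q F q).
  apply: countable_bigcupT_measurable => [|q].
    exact: countableP.
  rewrite /F; case: asboolP => // _.
  by apply: measurableX; exact: measurable_itv.
apply/seteqP; split => [p Up|p [q _]]; last first.
  by rewrite /F; case: asboolP => // qU /qU.
have /nbhs_ballP[e /= e0 eU] : nbhs p U by exact: oU.
have bet (x : R) : exists a b : rat,
    [/\ x - e < ratr a, ratr a < x, x < ratr b & ratr b < x + e].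
  have xe : x - e < x by rewrite ltrBlDr ltrDl.
  have ex : x < x + e by rewrite ltrDl.
  have [a aE] := rat_in_itvoo xe; have [b bE] := rat_in_itvoo ex.
  move: aE bE; rewrite !in_itv /= => /andP[? ?] /andP[? ?].
  by exists a, b; split.
have [a [b [a1 a2 b1 b2]]] := bet p.1; have [c [d [c1 c2 d1 d2]]] := bet p.2.
exists ((a, b), (c, d)) => //; rewrite /F; case: asboolP => [_|[]].
  by split; rewrite /= in_itv/= ?a2 ?b1 ?c2 ?d1.
move=> q [/=]; rewrite !in_itv /= => /andP[h1 h2] /andP[h3 h4]; apply: eU.
by split; rewrite /ball /= ltr_distlC; lra.
Qed.

Lemma open_continuous_measurable_plane (U : set (R * R)) (f : R * R -> R) :
  open U -> (forall p, U p -> {for p, continuous f}) ->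
  measurable_fun (U : set plane) f.
Proof.
move=> oU cf; apply: (measurability _ (RGenOpens.measurableE R)).
move=> _ [_ [a [b ->] <-]]; apply: open_measurable_plane.
move=> p [Up fp]; apply: filterI; first exact: oU.
by apply: (cf p Up); apply: (interval_open (R := R)) => //.
Qed.

(** By uniqueness of Lebesgue measure: the image of [mu] under t, scaled by k, agrees with [mu] on
    half-open intervals, hence everywhere. *)
Lemma ge0_integral_change_of_variable (k : {nonneg R}) (t : R -> R) (f : R -> \bar R) :
  measurable_fun [set: R] t ->
  (forall a b : R, a < b -> let I := `]a, b]%classic : set R in
    mu I = (k%:num%:E * mu (t @^-1` I))%E) ->
  measurable_fun [set: R] f -> (forall x, 0 <= f x)%E ->
  (\int[mu]_x f x = k%:num%:E * \int[mu]_x f (t x))%E.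
Proof.
move=> mt tk mf f0; pose u : measurableTypeR R -> measurableTypeR R := t.
have mu_ : measurable_fun [set: measurableTypeR R] u by exact: mt.
pose nu_ := [the {measure set (measurableTypeR R) -> \bar R} of pushforward mu u].
pose nu := nu_ mu_.
transitivity (\int[mscale k nu]_x f x)%E.
  apply: eq_measure_integral => A mA _; apply: lebesgue_measure_unique => //.
  move=> _ [[a b]] _ <-; have [ab|ba] := ltP a b; first exact: tk.
  by rewrite set_itv_ge ?measure0 // -leNgt bnd_simp.
rewrite ge0_integral_mscale//; congr (_ * _)%E.
have := @ge0_integral_pushforward _ _ _ _ R u mu_ mu setT f.
rewrite preimage_setT; apply => //.
Qed.

Lemma ge0_integral_translation (a : R) (f : R -> \bar R) :
  measurable_fun [set: R] f -> (forall x, 0 <= f x)%E ->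
  (\int[mu]_x f x = \int[mu]_x f (x + a)%R)%E.
Proof.
move=> mf f0; rewrite -[RHS]mul1e.
apply: (@ge0_integral_change_of_variable 1%:nng (fun x => x + a)) => //.
  exact: measurable_funD.
move=> u v uv /=.
rewrite (_ : _ @^-1` _ = `](u - a), (v - a)]%classic); last first.
  by apply/seteqP; split => x /=; rewrite !in_itv /= ltrBlDr lerBrDr.
rewrite !lebesgue_measure_itv /= !lte_fin ltrD2r uv mul1e -!EFinB.
by congr EFin; ring.
Qed.

Lemma ge0_integral_opp (f : R -> \bar R) :
  measurable_fun [set: R] f -> (forall x, 0 <= f x)%E ->
  (\int[mu]_x f x = \int[mu]_x f (- x)%R)%E.
Proof.
move=> mf f0; rewrite -[RHS]mul1e.
apply: (@ge0_integral_change_of_variable 1%:nng) => // u v uv /=.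
rewrite opp_preimage_itvbndbnd/= !lebesgue_measure_itv /= !lte_fin ltrN2.
by rewrite uv mul1e -!EFinB; congr EFin; ring.
Qed.

Lemma ge0_integral_scale (c : R) (f : R -> \bar R) : 0 < c ->
  measurable_fun [set: R] f -> (forall x, 0 <= f x)%E ->
  (\int[mu]_x f x = c%:E * \int[mu]_x f (x * c)%R)%E.
Proof.
move=> c0 mf f0.
apply: (@ge0_integral_change_of_variable (NngNum (ltW c0)) (fun x => x * c)) => //.
  exact: measurable_funM.
move=> u v uv /=.
rewrite (_ : _ @^-1` _ = `](u / c), (v / c)]%classic); last first.
  by apply/seteqP; split => x /=; rewrite !in_itv /= ltr_pdivrMr// ler_pdivlMr.
rewrite !lebesgue_measure_itv /= !lte_fin ltr_pM2r ?invr_gt0// uv -!EFinB -EFinM.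
by congr EFin; field; rewrite gt_eqF.
Qed.

(** The substitution y |-> a b / y swaps the endpoints a and b and preserves dy / y. *)
Lemma integral_inversion (a b : R) (G : R -> R) : 0 < a -> a <= b ->
  (forall y, a <= y <= b -> {for y, continuous G}) ->
  (\int[mu]_(y in `[a, b]) (G y / y)%:E =
   \int[mu]_(y in `[a, b]) (G (a * b / y) / y)%:E)%E.
Proof.
move=> a0 ab cG; have b0 : 0 < b by exact: lt_le_trans ab.
pose F (y : R) : R := a * b / y.
have Fa : F a = b by rewrite /F; field; rewrite gt_eqF.
have Fb : F b = a by rewrite /F; field; rewrite gt_eqF.
have dF (y : R) : y != 0 -> is_derive y 1 F (- (a * b / y ^+ 2)).
  move=> y0; have h := is_deriveZ (a * b) (is_deriveV (f := id) y0 (is_derive_id y (1 : R))).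
  by apply: (is_derive_eq h); rewrite /GRing.scale /= mulr1 mulrN.
have F'E (y : R) : y != 0 -> derive1 F y = - (a * b / y ^+ 2).
  by move=> y0; rewrite derive1E; have /@derive_val := dF y y0.
have yN0 (y : R) : a <= y -> y != 0 by move=> ay; rewrite gt_eqF// (lt_le_trans a0).
have cF (y : R) : y != 0 -> {for y, continuous F}.
  move=> y0; apply: differentiable_continuous; apply/derivable1_diffP.
  by have /@ex_derive := dF y y0.
have cF' (y : R) : y != 0 -> {for y, continuous (derive1 F)}.
  move=> y0; have : {for y, continuous ((fun z => - (a * b / z ^+ 2)) : R -> R)}.
    apply: continuousN; apply: continuousM; first exact: cvg_cst.
    by apply: continuousV; [rewrite expf_neq0|exact: exprn_continuous].
  have near_y : \forall z \near y, - (a * b / z ^+ 2) = derive1 F z.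
    have n0 : nbhs y [set z : R | z != 0].
      by apply: open_nbhs_nbhs; split; [exact: open_neq|exact: y0].
    by apply: filterS n0 => z /= z0; rewrite F'E.
  move=> h; rewrite /prop_for /continuous_at F'E//.
  exact: cvg_trans (near_eq_cvg near_y) h.
have := @integration_by_substitution_decreasing R F (fun y => G y / y) a b ab.
rewrite Fa Fb => ->.
- apply: eq_integral => y; rewrite inE /= in_itv /= => /andP[ay yb]; congr EFin.
  rewrite !fctE F'E ?yN0// /F; field.
  by rewrite yN0// !gt_eqF.
- move=> x y; rewrite !in_itv /= => /andP[ax _] /andP[ay _] xy.
  have x0 := lt_le_trans a0 ax; have y0 := lt_le_trans a0 ay.
  by rewrite /F ltr_pM2l ?mulr_gt0// ltf_pV2.
- by move=> x; rewrite in_itv /= => /andP[ax _]; apply/cF'/yN0/ltW.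
- apply: cvgP; apply: cvg_at_right_filter; exact/cF'/yN0.
- apply: cvgP; apply: cvg_at_left_filter; exact/cF'/yN0.
- split.
  + by move=> x; rewrite in_itv /= => /andP[ax _]; have /@ex_derive := dF x (yN0 _ (ltW ax)).
  + apply: cvg_at_right_filter; exact/cF/yN0.
  + apply: cvg_at_left_filter; exact/cF/yN0.
- apply: continuous_in_subspaceT => y; rewrite inE /= in_itv /= => yab.
  apply: continuousM; first exact: cG.
  by apply: continuousV; [apply: yN0; case/andP: yab|exact: cvg_id].
Qed.

End plane_measure.

(** * The Ford domain of level 4 *)

Section pointwise_continuity.
Context {R : realType} {T : topologicalType}.
Implicit Types (f g : T -> R) (p : T).

Lemma cts_add f g p : continuous_at p f -> continuous_at p g ->
  continuous_at p (fun q => f q + g q).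
Proof. by move=> cf cg; exact: cvgD. Qed.

Lemma cts_opp f p : continuous_at p f -> continuous_at p (fun q => - f q).
Proof. by move=> cf; exact: cvgN. Qed.

Lemma cts_sub f g p : continuous_at p f -> continuous_at p g ->
  continuous_at p (fun q => f q - g q).
Proof. by move=> cf cg; exact: cvgB. Qed.

Lemma cts_mul f g p : continuous_at p f -> continuous_at p g ->
  continuous_at p (fun q => f q * g q).
Proof. by move=> cf cg; exact: cvgM. Qed.

Lemma cts_div f g p : g p != 0 ->
  continuous_at p f -> continuous_at p g ->
  continuous_at p (fun q => f q / g q).
Proof. by move=> g0 cf cg; apply: cvgM cf _; exact: cvgV. Qed.

Lemma cts_exp f n p : continuous_at p f ->
  continuous_at p (fun q => f q ^+ n).
Proof.
move=> cf; elim: n => [|n IH]; first by exact: cvg_cst.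
rewrite (_ : (fun q => f q ^+ n.+1) = fun q => f q * f q ^+ n).
  exact: cts_mul.
by apply/funext => q; rewrite exprS.
Qed.

Lemma cts_norm f p : continuous_at p f -> continuous_at p (fun q => `|f q|).
Proof. by move=> cf; exact: (@cvg_norm R R^o). Qed.

Lemma cts_cst (c : R) p : continuous_at p (fun=> c : R).
Proof. exact: cvg_cst. Qed.

Lemma cts_pair f g p : continuous_at p f -> continuous_at p g ->
  continuous_at p (fun q => (f q, g q)).
Proof. by move=> cf cg; exact: (@cvg_pair _ _ _ _ (nbhs (f p)) (nbhs (g p))). Qed.

End pointwise_continuity.

Section ford4.
Context {R : realType}.
Notation mu := (@lebesgue_measure R).
Notation plane := (measurableTypeR R * measurableTypeR R)%type.

Definition half_plane : set (R * R) := [set p | 0 < p.2].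

Lemma open_half_plane : open half_plane.
Proof.
rewrite (_ : half_plane = snd @^-1` [set y : R | 0 < y])//.
by apply: open_comp => [p _|]; [exact: cvg_snd|exact: open_gt].
Qed.

(** The last condition says that the point lies outside the open discs of radius 1/4 centred at 1/4
    and -1/4, which are bounded by the isometric circles |4 tau - 1| = 1 and |4 tau + 1| = 1. *)
Definition ford4 : set (R * R) :=
  [set p | [/\ 0 < p.2, `|p.1| <= 1 / 2 & `|p.1| / 2 <= p.1 ^+ 2 + p.2 ^+ 2]].

Lemma ford4_half_plane : ford4 `<=` half_plane.
Proof. by move=> p []. Qed.

Lemma measurable_ford4 : measurable (ford4 : set plane).
Proof.
pose f1 (p : R * R) := `|p.1| - 1 / 2.
pose f2 (p : R * R) := `|p.1| / 2 - (p.1 ^+ 2 + p.2 ^+ 2).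
have cx (p : R * R) : continuous_at p (fst : R * R -> R) by exact: cvg_fst.
have cy (p : R * R) : continuous_at p (snd : R * R -> R) by exact: cvg_snd.
have c1 : continuous f1.
  by move=> p; rewrite /f1; apply: cts_sub; [exact: cts_norm|exact: cts_cst].
have c2 : continuous f2.
  move=> p; rewrite /f2; apply: cts_sub; last by apply: cts_add; exact: cts_exp.
  by apply: cts_mul; [exact: cts_norm|exact: cts_cst].
have o (f : R * R -> R) : continuous f -> measurable ([set p | 0 < f p] : set plane).
  move=> cf; apply: open_measurable_plane.
  rewrite (_ : [set p | 0 < f p] = f @^-1` [set y : R | 0 < y])//.
  apply: open_comp; first by move=> p _; exact: (cf p).
  exact: open_gt.
rewrite (_ : ford4 = half_plane `&` ~` [set p | 0 < f1 p] `&` ~` [set p | 0 < f2 p]).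
  apply: measurableI; last exact: measurableC (o _ c2).
  by apply: measurableI; [exact: (open_measurable_plane open_half_plane)|exact: measurableC (o _ c1)].
apply/seteqP; split=> p; rewrite /ford4 /half_plane /f1 /f2 /= => -[].
  by move=> h1 h2 h3; split; [split=> //|]; apply/negP; rewrite -leNgt subr_le0.
by move=> [h1 /negP h2] /negP h3; split=> //; move: h2 h3; rewrite -!leNgt !subr_le0.
Qed.

Lemma ford_domain4 : @ford_domain R 4 = ford4.
Proof.
have sq1 (z : R[i]) : (1 <= `|z|) = (1 <= sqnorm z).
  rewrite cabsE -[1]/((1 : R)%:C) lecR -cabs_sqnorm.
  by rewrite -{2}(expr1n R 2) ler_pXn2r ?nnegrE ?cabs_ge0.
apply/seteqP; split=> -[x y] [/= y0 x2] H; split=> //=; last first.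
  move=> g [hg /dvdzP[c cE]]; rewrite sq1.
  have dgE : g 0 0 * g 1 1 - g 0 1 * (c * 4) = 1 by rewrite -[c * 4]cE -det_mx2.
  have [a' [d' [_ dE]]] : exists a' d', g 0 0 = 2 * a' + 1 /\ g 1 1 = 2 * d' + 1.
    by apply: (@odd_factors _ _ (g 0 1 * c * 2)); rewrite -[RHS]dgE; ring.
  have -> : sqnorm (automorphy_factor (real_mx R g) (x +i* y)) =
      16 * c%:~R ^+ 2 * (x ^+ 2 + y ^+ 2) + 8 * (c%:~R * (g 1 1)%:~R * x)
      + (g 1 1)%:~R ^+ 2.
    rewrite /automorphy_factor !mxE cE /sqnorm cReD cImD cReMC cImMC /= rmorphM /=.
    rewrite (_ : 4%:Z%:~R = 4 :> R)//; ring.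
  pose C : R := `|c%:~R|; pose D : R := `|(g 1 1)%:~R|; pose t := 2 * `|x|.
  have int_sq (z : int) : z != 0 -> 1 <= (z%:~R : R) ^+ 2.
    by move=> z0; rewrite -rmorphXn /= ler1z; lia.
  have D1 : 1 <= D ^+ 2.
    by rewrite real_normK ?num_real// int_sq// dE; lia.
  have E1 : 1 <= (2 * C - D) ^+ 2.
    have -> : 2 * C - D = (2 * `|c| - `|g 1 1|)%:~R :> R.
      by rewrite rmorphB rmorphM /= !intr_norm.
    by apply: int_sq; rewrite dE; lia.
  have t0 : 0 <= t by rewrite mulr_ge0.
  have t1 : t <= 1 by rewrite /t; lra.
  have cdx : - (C * D * `|x|) <= c%:~R * (g 1 1)%:~R * x.
    by rewrite /C /D -!normrM lerNl; apply: (le_trans (ler_norm _)); rewrite normrN.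
  have C2 : c%:~R ^+ 2 = C ^+ 2 :> R by rewrite real_normK ?num_real.
  have D2 : (g 1 1)%:~R ^+ 2 = D ^+ 2 :> R by rewrite real_normK ?num_real.
  rewrite C2 D2; move: cdx; set e := _ * x => cdx.
  have H' : C ^+ 2 * (`|x| / 2) <= C ^+ 2 * (x ^+ 2 + y ^+ 2).
    by rewrite ler_wpM2l ?sqr_ge0.
  (* For the lower row (4 c, d), the circle condition bounds |4 c tau + d|^2 below by 4 t C^2 - 4 t
     C D + D^2, which is this convex combination of two odd squares: D is odd because a d is 1
     modulo 4. *)
  have : 1 <= (1 - t) * D ^+ 2 + t * (2 * C - D) ^+ 2.
    have t1' : 0 <= 1 - t by lra.
    have := ler_wpM2l t0 E1; have := ler_wpM2l t1' D1; lra.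
  rewrite /t => H''; lra.
(* Conversely, the lower rows (4, 1) and (-4, 1) already impose the two circles of [ford4]. *)
have hp (s : int) : (s == 1) || (s == -1) -> 0 <= 2 * (x ^+ 2 + y ^+ 2) + s%:~R * x.
  move=> s1; have := H (mx2 1 0 (4 * s) 1); rewrite sq1 => h.
  have : Gamma0 4 (mx2 1 0 (4 * s) 1).
    split; first by rewrite /SL2Z /= det_mx2 !mx2E; ring.
    by rewrite mx2E; apply/dvdzP; exists s; lia.
  move=> /h; rewrite /automorphy_factor real_mx2 !mx2E /sqnorm cReD cImD cReMC cImMC /= rmorphM /=.
  by case/orP: s1 => /eqP->; rewrite /=; lra.
have h1 := hp 1 isT; have h2 := hp (-1) isT.
by have [x0|x0] := ler0P x; lra.
Qed.

(* The coordinates are the slope s = x / y and y. *)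
Lemma ge0_integral_slopes (f : R * R -> \bar R) :
  measurable_fun [set: plane] f -> (forall p, 0 <= f p)%E ->
  (forall p, ~ half_plane p -> f p = 0%E) ->
  (\int[(mu \x mu)%E]_p f p = \int[mu]_s \int[mu]_y (y%:E * f (s * y, y)%R))%E.
Proof.
move=> mf f0 fH.
have mg : measurable_fun [set: plane] (fun p : plane => (p.2%:E * f ((p.1 * p.2)%R, p.2))%E).
  apply: emeasurable_funM; first by apply/measurable_EFinP; exact: measurable_snd.
  apply: (measurableT_comp mf).
  apply/measurable_fun_pairP; split => /=; last exact: measurable_snd.
  by apply: measurable_funM; [exact: measurable_fst|exact: measurable_snd].
have g0 (p : plane) : (0 <= p.2%:E * f ((p.1 * p.2)%R, p.2))%E.
  have [y0|y0] := ltP 0 p.2; first by rewrite mule_ge0// lee_fin ltW.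
  by rewrite fH ?mule0// /half_plane /=; apply/negP; rewrite -leNgt.
rewrite (@fubini_tonelli2 _ _ _ _ _ mu mu f mf f0).
have -> := fubini_tonelli (m1 := mu) (m2 := mu) _ mg g0.
apply: eq_integral => y _; rewrite /fubini_G.
have mfy : measurable_fun [set: R] (fun x => f (x, y)).
  exact: (measurableT_comp mf).
have [y0|y0] := ltP 0 y.
  rewrite (ge0_integral_scale y0)// -ge0_integralZl ?lee_fin ?ltW//=.
  apply: (measurableT_comp mfy); exact: measurable_funM.
have fy0 x : f (x, y) = 0%E by apply: fH; apply/negP; rewrite -leNgt.
by under [RHS]eq_integral do rewrite fy0 mule0; under eq_integral do rewrite fy0.
Qed.

Implicit Types (F : R * R -> R) (s : R).

(** The map tau |-> -1/(4 tau) in real coordinates. *)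
Definition inversion (p : R * R) : R * R :=
  (- p.1 / (4 * (p.1 ^+ 2 + p.2 ^+ 2)), p.2 / (4 * (p.1 ^+ 2 + p.2 ^+ 2))).

Definition weighted (F : R * R -> R) : R * R -> \bar R :=
  (fun p => (F p / p.2 ^+ 2)%:E) \_ ford4.

Lemma measurable_weighted F : (forall p, half_plane p -> continuous_at p F) ->
  measurable_fun [set: plane] (weighted F).
Proof.
move=> cF; apply/(measurable_restrictT _ measurable_ford4).
apply: (@measurable_funS _ _ _ _ (half_plane : set plane)).
- exact: (open_measurable_plane open_half_plane).
- exact: ford4_half_plane.
apply/measurable_EFinP; apply: open_continuous_measurable_plane.
  exact: open_half_plane.
move=> p Hp; apply: cts_div; [by rewrite expf_neq0// gt_eqF|exact: cF|].
by apply: cts_exp; exact: cvg_snd.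
Qed.

(** The ray of slope s meets [ford4] in a segment a <= y <= b, where a comes from the circle and b
    from the strip. As a b = 1 / (4 (1 + s^2)), [inversion] sends (s y, y) to the ray of slope -s at
    height a b / y. The Jacobian y turns the weight 1 / y^2 into 1 / y, so [integral_inversion]
    applies. *)
Lemma inversion_slopes F s : s != 0 -> (forall p, 0 <= F p) ->
  (forall p, half_plane p -> continuous_at p F) ->
  (\int[mu]_y (y%:E * weighted (F \o inversion) (s * y, y)%R) =
   \int[mu]_y (y%:E * weighted F (- s * y, y)%R))%E.
Proof.
move=> s0 F0 cF; pose a := `|s| / (2 * (1 + s ^+ 2)); pose b := (2 * `|s|)^-1.
have ns0 : 0 < `|s| by rewrite normr_gt0.
have s2 : 0 < 1 + s ^+ 2 by rewrite ltr_pwDl ?sqr_ge0.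
have a0 : 0 < a by rewrite divr_gt0 ?mulr_gt0.
have ab : a <= b.
  rewrite /a /b ler_pdivrMr ?mulr_gt0//.
  have -> : (2 * `|s|)^-1 * (2 * (1 + s ^+ 2)) = (1 + s ^+ 2) / `|s|.
    by field; rewrite gt_eqF.
  by rewrite ler_pdivlMr// -expr2 real_normK ?num_real// lerDr ler01.
have ford (t y : R) : `|t| = `|s| -> ford4 (t * y, y) <-> `[a, b]%classic y.
  move=> ts; have t2 : t ^+ 2 = s ^+ 2 by rewrite -[LHS]real_normK ?num_real// ts real_normK ?num_real.
  rewrite /ford4 /= in_itv /= normrM ts exprMn t2.
  have -> : s ^+ 2 * y ^+ 2 + y ^+ 2 = (1 + s ^+ 2) * y ^+ 2 by ring.
  have aE : (a <= y) = (`|s| / 2 <= (1 + s ^+ 2) * y).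
    by rewrite /a invfM mulrA ler_pdivrMr// [y * _]mulrC.
  have bE : (y <= b) = (`|s| * y <= 1 / 2).
    by rewrite /b -[_^-1]mul1r ler_pdivlMr ?mulr_gt0//; apply/idP/idP => ?; lra.
  split=> [[y0 h1 h2]|/andP[h1 h2]].
    rewrite aE bE; move: h1 h2; rewrite (gtr0_norm y0) => -> h2; rewrite andbT.
    rewrite -(ler_pM2r y0) mulrAC (le_trans h2)//.
    by rewrite expr2 mulrA.
  have y0 : 0 < y by exact: lt_le_trans h1.
  rewrite (gtr0_norm y0) -bE; split=> //; rewrite mulrAC expr2 mulrA ler_pM2r//.
  by rewrite -aE.
have slice (F' : R * R -> R) t y : `|t| = `|s| ->
    (y%:E * weighted F' (t * y, y)%R)%E =
    ((fun y => (F' (t * y, y)%R / y)%:E) \_ `[a, b]%classic) y.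
  move=> ts; rewrite /weighted !patchE.
  have [h|h] := pselect (ford4 (t * y, y)).
    have [y0 _ _] := h; rewrite mem_set// mem_set; last by apply/(ford _ _ ts).
    by rewrite -EFinM; congr EFin => /=; field; rewrite gt_eqF.
  by rewrite memNset// mule0 memNset// => /(ford _ _ ts).
pose G y := F (- s * y, y).
transitivity (\int[mu]_(y in `[a, b]) (G (a * b / y) / y)%:E)%E.
  rewrite [RHS]integral_mkcond; apply: eq_integral => y _.
  rewrite slice// !patchE; case: ifPn => //; rewrite inE /= in_itv /= => /andP[ay _].
  have y0 : 0 < y by exact: lt_le_trans ay.
  congr (F _ / y)%:E; rewrite /inversion /=.
  have -> : a * b / y = y / (4 * ((s * y) ^+ 2 + y ^+ 2)).
    have -> : (s * y) ^+ 2 + y ^+ 2 = (1 + s ^+ 2) * y ^+ 2 by ring.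
    by rewrite /a /b; field; rewrite (gt_eqF y0) (gt_eqF ns0) (gt_eqF s2).
  by congr (_, _); ring.
rewrite -integral_inversion//.
  rewrite integral_mkcond; apply: eq_integral => y _.
  by rewrite slice ?normrN.
move=> y /andP[ay _]; have y0 : 0 < y by exact: lt_le_trans ay.
apply: (@continuous_comp _ _ _ (fun y : R => (- s * y, y)) F); last exact: cF.
apply: cts_pair; last exact: cvg_id.
by apply: cts_mul; [exact: cts_cst|exact: cvg_id].
Qed.

Lemma integral_ford4_inversion F : (forall p, 0 <= F p) ->
  (forall p, half_plane p -> continuous_at p F) ->
  (\int[(mu \x mu)%E]_(p in ford4) (F p / p.2 ^+ 2)%:E =
   \int[(mu \x mu)%E]_(p in ford4) (F (inversion p) / p.2 ^+ 2)%:E)%E.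
Proof.
move=> F0 cF.
have cFi p : half_plane p -> continuous_at p (F \o inversion).
  move=> Hp; have n0 : 0 < 4 * (p.1 ^+ 2 + p.2 ^+ 2).
    by rewrite mulr_gt0// ltr_wpDl ?sqr_ge0 ?exprn_gt0.
  have cfst : continuous_at p (fst : R * R -> R) by exact: cvg_fst.
  have csnd : continuous_at p (snd : R * R -> R) by exact: cvg_snd.
  have cn : continuous_at p (fun p : R * R => 4 * (p.1 ^+ 2 + p.2 ^+ 2)).
    by apply: cts_mul; [exact: cts_cst|apply: cts_add; exact: cts_exp].
  apply: continuous_comp; last by apply: cF; rewrite /half_plane /= divr_gt0.
  apply: cts_pair.
    by apply: cts_div; [rewrite gt_eqF|exact: cts_opp|exact: cn].
  by apply: cts_div; [rewrite gt_eqF|exact: csnd|exact: cn].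
have w0 F' p : (forall p, 0 <= F' p) -> (0 <= weighted F' p)%E.
  by move=> F'0; apply: erestrict_ge0 => q _; rewrite lee_fin divr_ge0 ?sqr_ge0.
have wH F' p : ~ half_plane p -> weighted F' p = 0%E.
  by move=> Hp; rewrite /weighted patchE memNset//; apply: contra_not Hp => /ford4_half_plane.
have Fi0 p : 0 <= (F \o inversion) p by exact: F0.
rewrite integral_mkcond [RHS]integral_mkcond -/(weighted F) -/(weighted (F \o inversion)).
rewrite ge0_integral_slopes; [|exact: measurable_weighted|by move=> p; exact: w0|exact: wH].
rewrite ge0_integral_slopes; [|exact: measurable_weighted|by move=> p; exact: w0|exact: wH].
pose J F' (s : R) := (\int[mu]_y (y%:E * weighted F' (s * y, y)%R))%E.
have mJ F' : (forall p, 0 <= F' p) -> (forall p, half_plane p -> continuous_at p F') ->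
    measurable_fun [set: R] (J F').
  move=> F'0 cF'; apply: (@measurable_fun_fubini_tonelli_F _ _ _ _ _ mu
     (fun p : plane => (p.2%:E * weighted F' ((p.1 * p.2)%R, p.2))%E)).
    apply: emeasurable_funM; first by apply/measurable_EFinP; exact: measurable_snd.
    apply: (measurableT_comp (measurable_weighted cF')).
    apply/measurable_fun_pairP; split => /=; last exact: measurable_snd.
    by apply: measurable_funM; [exact: measurable_fst|exact: measurable_snd].
  move=> p /=; have [y0|y0] := ltP 0 p.2; first by rewrite mule_ge0 ?w0// lee_fin ltW.
  by rewrite wH ?mule0// /half_plane /=; apply/negP; rewrite -leNgt.
have J0 F' s : (forall p, 0 <= F' p) -> (0 <= J F' s)%E.
  move=> F'0; apply: integral_ge0 => y _.
  have [y0|y0] := ltP 0 y; first by rewrite mule_ge0 ?w0// lee_fin ltW.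
  by rewrite wH ?mule0// /half_plane /=; apply/negP; rewrite -leNgt.
rewrite -/(J F) -/(J (F \o inversion)).
rewrite ge0_integral_opp; [|exact: mJ|by move=> s; exact: J0].
(* The ray of slope 0 lies entirely in [ford4], so its slice is no compact segment; this single
   slope is discarded as a null set. *)
have m1 : measurable ([set: R] `\ 0) by exact: measurableD.
rewrite -[LHS](integral_setD1 (r := 0) m1); last first.
  by apply: measurable_funTS; apply: (measurableT_comp (mJ _ F0 cF)).
rewrite -[RHS](integral_setD1 (r := 0) m1); last by apply: measurable_funTS; exact: mJ.
apply: eq_integral => s; rewrite inE => -[_ /eqP s0].
by rewrite /J inversion_slopes.
Qed.

End ford4.

(** * Growth at the cusps *)

Section cuspidal_bounds.
Context {R : realType}.
Notation mu := (@lebesgue_measure R).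
Notation plane := (measurableTypeR R * measurableTypeR R)%type.
Implicit Types (f u v : R[i] -> R[i]) (p : R * R).
Local Notation Re := complex.Re.
Local Notation Im := complex.Im.

Definition uhp_point p : R[i] := p.1 +i* p.2.

Lemma holomorphic_continuous f p e : holomorphic f -> half_plane p -> 0 < e ->
  \forall q \near p, cabs (f (uhp_point p) - f (uhp_point q)) < e.
Proof.
move=> hf Hp e0; have /derivable1_diffP/differentiable_continuous cf := hf (uhp_point p) Hp.
have {cf} : \forall z \near (uhp_point p : R[i]^o), `|(f (uhp_point p) : R[i]^o) - f z| < e%:C.
  by move/cvgrPdist_lt : cf; apply; rewrite ltcR.
move=> /nbhs_ballP[d /= d0 dU].
move: d0; rewrite ltcE /= => /andP[/eqP dI d0].
apply/nbhs_ballP; exists (Re d / 2); first by rewrite /= divr_gt0.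
move=> q [/= q1 q2]; have : ball (uhp_point p : R[i]^o) d (uhp_point q).
  rewrite /ball /= /ball_ cabsE ltcE /= dI eqxx /=.
  apply: le_lt_trans (cabs_Re_Im _) _ => /=.
  by move: q1 q2; rewrite /ball /= => q1 q2; rewrite [ltRHS](splitr (Re d)) ltrD.
by move=> /dU /=; rewrite cabsE ltcR.
Qed.

Lemma continuous_Re f p : holomorphic f -> half_plane p ->
  continuous_at p (fun q => Re (f (uhp_point q))).
Proof.
move=> hf Hp; apply/(@cvgrPdist_lt _ R^o) => e e0.
have := holomorphic_continuous hf Hp e0; apply: filterS => q.
apply: le_lt_trans; apply: le_trans (normr_Re _).
by rewrite cReD; case: (f (uhp_point q)).
Qed.

Lemma continuous_Im f p : holomorphic f -> half_plane p ->
  continuous_at p (fun q => Im (f (uhp_point q))).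
Proof.
move=> hf Hp; apply/(@cvgrPdist_lt _ R^o) => e e0.
have := holomorphic_continuous hf Hp e0; apply: filterS => q.
apply: le_lt_trans; apply: le_trans (normr_Im _).
by rewrite cImD; case: (f (uhp_point q)).
Qed.

(** The power of det(M) in the slash operator is the one for which |f| y^(k/2) is carried along
    without a constant, since Im(M tau) = det(M) Im(tau) / |c tau + d|^2. *)
Lemma cabs_slash k (M : 'M[R]_2) f tau : ~~ odd k -> 0 < \det M ->
  upper_half_plane tau ->
  cabs (slash k M f tau) * Im tau ^+ k./2 =
  cabs (f (moebius M tau)) * Im (moebius M tau) ^+ k./2.
Proof.
move=> ke dM Ht; have a0 := automorphy_factor_neq0 (lt0r_neq0 dM) Ht.
rewrite Im_moebius// -cabs_sqnorm /slash powR_half_even ?ltW//.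
rewrite !cabsM cabsV cabsX cabs_real ?exprn_ge0 ?ltW//.
have kE : k = (2 * k./2)%N by rewrite mul2n -[LHS]odd_double_half (negbTE ke).
set s := cabs (automorphy_factor M tau) ^+ 2; rewrite !exprMn exprVn.
by rewrite /s -exprM -kE; ring.
Qed.

Lemma slash1 k f tau : slash k (1%:M : 'M[R]_2) f tau = f tau.
Proof.
rewrite /slash det1 powR1 mul1r /moebius /automorphy_factor !mxE /=.
by rewrite !mul0r !mul1r !addr0 !add0r expr1n invr1 mul1r mulr1.
Qed.

Lemma cuspidal_vanishes k u : cuspidal k u -> vanishes_at_infinity u.
Proof.
move=> cu; have := cu 1%:M; rewrite /SL2Z /= det1 => /(_ erefl).
by apply: vanishes_eq => t _; rewrite /real_mx map_mx1 slash1.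
Qed.

(* Moving a cusp to infinity: near it, [Im (g tau)] is of order [1 / Im tau]. *)
Lemma cuspidal_bound_near_cusp k u (g g' : 'M[int]_2) : ~~ odd k -> cuspidal k u ->
  SL2Z g -> SL2Z g' -> g' *m g = 1%:M ->
  exists2 C, 0 <= C & forall p, 0 < p.2 -> p.2 < 1 / 4 ->
    sqnorm (automorphy_factor (real_mx R g) (uhp_point p)) <= 8 * p.2 ^+ 2 ->
    cabs (u (uhp_point p)) * p.2 ^+ k./2 <= C * p.2.
Proof.
move=> ke cu hg hg' gg'.
have dg : 0 < \det (real_mx R g) by rewrite det_real_mx_gt0 hg.
have dg' : 0 < \det (real_mx R g') by rewrite det_real_mx_gt0 hg'.
have h2 : 0 < (1 / 2 : R) by rewrite divr_gt0.
(* One power more than the weight requires: after division by Im s >= 1 / (8 y) it yields the factor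
   y of the conclusion. The threshold 1/2 is met since y < 1/4. *)
have [C C0 uC] := vanishes_bounded (k./2).+1 h2 (cu g' hg').
exists (C * 8) => [|p p0 p4 ap]; first by rewrite mulr_ge0.
have Hp : upper_half_plane (uhp_point p) by [].
have a0 := automorphy_factor_neq0 (lt0r_neq0 dg) Hp.
have -> : u (uhp_point p) = slash k (real_mx R g) (slash k (real_mx R g') u) (uhp_point p).
  by rewrite slashM// -real_mxM gg' /real_mx map_mx1 slash1.
rewrite cabs_slash//; set s := moebius _ _.
have Is : 1 / (8 * p.2) <= Im s.
  rewrite Im_moebius// det_real_mx hg div1r mul1r.
  rewrite ler_pdivlMr ?sqnorm_gt0// mulrC ler_pdivrMr ?mulr_gt0//.
  by rewrite (le_trans ap)// expr2 mulrCA.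
have s0 : 0 < Im s by apply: lt_le_trans Is; rewrite divr_gt0 ?mulr_gt0.
have /uC : 1 / 2 <= Im s.
  apply: le_trans Is; rewrite ler_pdivlMr ?mulr_gt0//; lra.
rewrite exprSr mulrA -ler_pdivlMr// => /le_trans; apply.
rewrite -mulrA ler_wpM2l// -[_^-1]mul1r ler_pdivrMr//.
by rewrite mulrC -ler_pdivrMr ?mulr_gt0.
Qed.

(** The bound C serves at infinity, the bound C y at the cusps on the real axis. For a product of
    two forms they give C D min(1, y^2), which makes the integrand of the Petersson product at most
    2 C D / (1 + y^2). *)
Lemma cuspidal_bound_ford4 k u : ~~ odd k -> cuspidal k u ->
  exists2 C, 0 <= C & forall p, ford4 p ->
    cabs (u (uhp_point p)) * p.2 ^+ k./2 <= C /\
    cabs (u (uhp_point p)) * p.2 ^+ k./2 <= C * p.2.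
Proof.
move=> ke cu.
have h4 : 0 < (1 / 4 : R) by rewrite divr_gt0.
have [C0 C00 b0] := vanishes_bounded k./2 h4 (cuspidal_vanishes cu).
have det_rV (c : int) : SL2Z (mx2 1 0 c 1).
  by rewrite /SL2Z /= det_mx2 !mx2E mul0r subr0 mulr1.
have mul_rV (c : int) : mx2 1 0 (- c) 1 *m mx2 1 0 c 1 = 1%:M.
  by apply: matrix2P; rewrite mulmx2 !mx2E !mxE /=; ring.
have [|||C1 C10 b1] := @cuspidal_bound_near_cusp k u (mx2 0 (-1) 1 0) (mx2 0 1 (-1) 0) ke cu.
- by rewrite /SL2Z /= det_mx2 !mx2E.
- by rewrite /SL2Z /= det_mx2 !mx2E.
- by apply: matrix2P; rewrite mulmx2 !mx2E !mxE.
have [C2 C20 b2] := cuspidal_bound_near_cusp ke cu (det_rV (-2)) (det_rV _) (mul_rV _).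
have [C3 C30 b3] := cuspidal_bound_near_cusp ke cu (det_rV 2) (det_rV _) (mul_rV _).
(* The factor 4 turns the bound C0, valid for y >= 1/4, into one by 4 C0 y. *)
exists (4 * C0 + C1 + C2 + C3); first by rewrite !addr_ge0// mulr_ge0.
move=> [x y] [/= y0 x2 xy]; set U := cabs _ * _.
have bound C : 0 <= C -> C <= C1 + C2 + C3 -> y < 1 / 4 -> U <= C * y ->
    U <= 4 * C0 + C1 + C2 + C3 /\ U <= (4 * C0 + C1 + C2 + C3) * y.
  move=> CC0 CC y4 UC; have := ler_wpM2r (ltW y0) CC.
  have := mulr_ge0 C00 (ltW y0); have := ler_wpM2l CC0 (ltW y4).
  by split; lra.
have [y4|y4] := leP (1 / 4) y.
  have UC : U <= C0 by exact: (b0 (uhp_point (x, y))).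
  have := ler_wpM2l C00 y4; have := mulr_ge0 C10 (ltW y0).
  have := mulr_ge0 C20 (ltW y0); have := mulr_ge0 C30 (ltW y0).
  by split; lra.
(* Here t is the horizontal distance to the nearest cusp; t <= 1/4 gives 2 t^2 <= t / 2. Hence
   |tau|^2 <= 2 y^2 near 0, and |1 - 2 tau|^2 or |1 + 2 tau|^2 is at most 8 y^2 near 1/2 or -1/2,
   the constant of [cuspidal_bound_near_cusp]. *)
have sq (t : R) : 0 <= t -> t <= 1 / 4 -> t / 2 <= t ^+ 2 + y ^+ 2 -> t ^+ 2 <= y ^+ 2.
  by move=> t0 t4; rewrite expr2 => ty; have := ler_wpM2l t0 t4; lra.
have x0 := normr_ge0 x; have xx : `|x| ^+ 2 = x ^+ 2 by rewrite real_normK ?num_real.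
have [x4|x4] := leP `|x| (1 / 4).
  apply: (bound C1) => //; first lra.
  apply: (b1 (x, y)) => //; have := sq _ x0 x4; rewrite xx => /(_ xy) xley.
  rewrite /automorphy_factor real_mx2 !mx2E /sqnorm cReD cImD cReMC cImMC /=.
  have := sqr_ge0 y; lra.
(* The circle condition is unchanged when |x| is replaced by 1/2 - |x|. *)
have x'y := sq (1 / 2 - `|x|).
have {}x'y : (1 / 2 - `|x|) ^+ 2 <= y ^+ 2.
  apply: x'y; [lra|lra|]; rewrite sqrrB xx; lra.
have [xpos|xneg] := ler0P x.
  apply: (bound C3) => //; first lra.
  apply: (b3 (x, y)) => //; move: x'y; rewrite ler0_norm// => x'y.
  rewrite /automorphy_factor real_mx2 !mx2E /sqnorm cReD cImD cReMC cImMC /=.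
  rewrite (_ : 2%:~R = 2 :> R)//; lra.
apply: (bound C2) => //; first lra.
apply: (b2 (x, y)) => //; move: x'y; rewrite gtr0_norm// => x'y.
rewrite /automorphy_factor real_mx2 !mx2E /sqnorm cReD cImD cReMC cImMC /= rmorphN /=.
rewrite (_ : 2%:~R = 2 :> R)//; lra.
Qed.

End cuspidal_bounds.

(** * Integrability of the Petersson integrand *)

Section petersson_product.
Context {R : realType}.
Notation mu := (@lebesgue_measure R).
Notation mu2 := (mu \x mu)%E.
Notation plane := (measurableTypeR R * measurableTypeR R)%type.
Implicit Types (f h u v : R[i] -> R[i]) (p : R * R) (k : nat).
Local Notation Re := complex.Re.
Local Notation Im := complex.Im.

(** The factor 1 / y^2 is left out because it belongs to the invariant measure. The real part
    suffices: the argument ends with an integral of |F|^2. *)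
Definition pet k f h p : R := Re (f (uhp_point p) * (h (uhp_point p))^*) * p.2 ^+ k.

Lemma Re_petersson k f h : Re (petersson 4 k f h) =
  Rintegral mu2 ford4 (fun p : R * R => pet k f h p / p.2 ^+ 2).
Proof.
rewrite /petersson /cintegral /= ford_domain4; apply: eq_Rintegral => p _.
by rewrite /= mulrC cReMC /pet /uhp_point mulrC mulrA.
Qed.

Lemma pet_continuous k f h p : holomorphic f -> holomorphic h -> half_plane p ->
  continuous_at p (pet k f h).
Proof.
move=> hf hh Hp.
rewrite (_ : pet k f h = fun q => (Re (f (uhp_point q)) * Re (h (uhp_point q)) +
    Im (f (uhp_point q)) * Im (h (uhp_point q))) * q.2 ^+ k); last first.
  apply/funext => q; rewrite /pet cReM; congr (_ * _).
  by case: (h (uhp_point q)) => a b /=; rewrite mulrN opprK.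
apply: cts_mul; last by apply: cts_exp; exact: cvg_snd.
apply: cts_add; apply: cts_mul.
- exact: continuous_Re.
- exact: continuous_Re.
- exact: continuous_Im.
- exact: continuous_Im.
Qed.

Lemma measurable_pet k f h : holomorphic f -> holomorphic h ->
  measurable_fun (half_plane : set plane) (fun p : R * R => (pet k f h p / p.2 ^+ 2)%:E).
Proof.
move=> hf hh; apply/measurable_EFinP; apply: open_continuous_measurable_plane.
  exact: open_half_plane.
move=> p Hp; apply: cts_div; first by rewrite expf_neq0// gt_eqF.
  exact: pet_continuous.
by apply: cts_exp; exact: cvg_snd.
Qed.

(** The majorant for [integrable_pet]: K / (1 + y^2) has integral K pi / 2 on each vertical
    half-line, and the strip has width 1. *)
Lemma integrable_strip (K : R) : 0 <= K ->
  mu2.-integrable (`[- (1 / 2), 1 / 2]%classic `*` `[0, +oo[%classic : set plane)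
    (fun p : R * R => (K * (oneDsqr p.2)^-1)%:E).
Proof.
move=> K0; set S := _ `*` _.
have mS : measurable (S : set plane) by apply: measurableX; exact: measurable_itv.
have mg : measurable_fun [set: plane] (fun p : plane => (K * (oneDsqr p.2)^-1)%:E).
  apply/measurable_EFinP; apply: measurable_funM => //.
  apply: (measurableT_comp (f := fun y : R => (oneDsqr y)^-1)) => //.
  by apply: continuous_measurable_fun; exact: continuous_oneDsqrV.
apply/(integrable_mkcond _ mS)/integrable12ltyP.
  by apply/(measurable_restrictT _ mS); exact: measurable_funTS.
pose c : \bar R := (K * (pi / 2))%:E.
pose I := `[- (1 / 2), 1 / 2]%classic : set R.
apply: (@le_lt_trans _ _ (\int[mu]_(x in I) (cst c x))%E); last first.
  have mI : measurable I by exact: measurable_itv.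
  rewrite integral_cst//= (lebesgue_measure_itv `[- (1 / 2), 1 / 2] : mu I = _) /=.
  by case: ifP => _; rewrite ?mule0 ?ltry// -EFinB -EFinM ltry.
rewrite le_eqVlt; apply/orP; left; apply/eqP.
rewrite [RHS]integral_mkcond; apply: eq_integral => x _.
have [xS|xS] := pselect (I x).
    rewrite [RHS]patchE mem_set//= /c EFinM -integral0y_oneDsqr -ge0_integralZl//=.
    - rewrite [RHS]integral_mkcond; apply: eq_integral => y _; rewrite !patchE.
      have [yS|yS] := pselect (`[0, +oo[%classic y).
        by rewrite mem_set//= mem_set//= ger0_norm ?EFinM// mulr_ge0// invr_ge0 (le_trans ler01)// oneDsqr_ge1.
      by rewrite memNset ?memNset ?abse0// => -[].
    - apply: measurable_funTS; apply/measurable_EFinP.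
      by apply: continuous_measurable_fun; exact: continuous_oneDsqrV.
  rewrite [RHS]patchE memNset//; apply: integral0_eq => y _.
  by rewrite patchE memNset ?abse0// => -[].
Qed.

Lemma integrable_pet k f h : ~~ odd k -> holomorphic f -> holomorphic h ->
  cuspidal k f -> cuspidal k h ->
  mu2.-integrable (ford4 : set plane) (fun p : R * R => (pet k f h p / p.2 ^+ 2)%:E).
Proof.
move=> ke hf hh cf ch.
have [C C0 fC] := cuspidal_bound_ford4 ke cf.
have [D D0 hD] := cuspidal_bound_ford4 ke ch.
have K0 : 0 <= 2 * (C * D) by rewrite !mulr_ge0.
have sub : ford4 `<=` (`[- (1 / 2), 1 / 2]%classic `*` `[0, +oo[%classic : set (R * R)).
  move=> p [p0 p1 _]; split; rewrite /= in_itv /=; last by rewrite andbT ltW.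
  by rewrite -ler_norml.
have mS : measurable (`[- (1 / 2), 1 / 2]%classic `*` `[0, +oo[%classic : set plane).
  by apply: measurableX; exact: measurable_itv.
apply: (le_integrable measurable_ford4 _ _
  (integrableS mS measurable_ford4 sub (integrable_strip K0))).
- apply: (@measurable_funS _ _ _ _ (half_plane : set plane)).
  + exact: (open_measurable_plane open_half_plane).
  + exact: ford4_half_plane.
  + exact: measurable_pet.
- move=> p Dp; have [p0 _ _] := Dp; have [U1 U2] := fC p Dp; have [V1 V2] := hD p Dp.
  rewrite /= lee_fin [leRHS]ger0_norm; last first.
    by rewrite mulr_ge0// invr_ge0 (le_trans ler01)// oneDsqr_ge1.
  rewrite ler_pdivlMr; last by rewrite (lt_le_trans ltr01)// oneDsqr_ge1.
  rewrite normrM normfV (ger0_norm (sqr_ge0 p.2)) mulrAC ler_pdivrMr ?exprn_gt0//.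
  set U := cabs _ * _ in U1 U2; set V := cabs _ * _ in V1 V2.
  have U0 : 0 <= U by rewrite mulr_ge0 ?cabs_ge0// exprn_ge0// ltW.
  have V0 : 0 <= V by rewrite mulr_ge0 ?cabs_ge0// exprn_ge0// ltW.
  have petUV : `|pet k f h p| <= U * V.
    rewrite /pet normrM (ger0_norm (exprn_ge0 k (ltW p0))).
    have -> : U * V = cabs (f (uhp_point p) * (h (uhp_point p))^*) * p.2 ^+ k.
      have cJ : cabs ((h (uhp_point p))^*) = cabs (h (uhp_point p)).
        by rewrite /cabs normcJ.
      have kE : k = (k./2 + k./2)%N by rewrite addnn -[LHS]odd_double_half (negbTE ke).
      by rewrite cabsM cJ [in RHS]kE exprD /U /V; ring.
    by rewrite ler_wpM2r ?normr_Re// exprn_ge0// ltW.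
  have UV1 : U * V <= C * D by exact: ler_pM.
  have UV2 : U * V <= C * D * p.2 ^+ 2.
    have -> : C * D * p.2 ^+ 2 = (C * p.2) * (D * p.2) by ring.
    exact: ler_pM.
  have := ler_wpM2r (sqr_ge0 p.2) UV1; have := ler_wpM2r (sqr_ge0 p.2) petUV.
  rewrite /oneDsqr /=; lra.
Qed.

Lemma integral_plane_translation (a : R) (g : R * R -> \bar R) :
  measurable_fun [set: plane] g ->
  (\int[mu2]_p g p = \int[mu2]_p g ((p.1 + a)%R, p.2))%E.
Proof.
have mt : measurable_fun [set: plane] (fun p : plane => ((p.1 + a)%R, p.2) : plane).
  apply: measurable_fun_pair; last exact: measurable_snd.
  by apply: measurable_funD => //; exact: measurable_fst.
have ge0 (g' : plane -> \bar R) : measurable_fun [set: plane] g' ->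
    (forall p, 0 <= g' p)%E ->
    (\int[mu2]_p g' p = \int[mu2]_p g' ((p.1 + a)%R, p.2))%E.
  move=> mg g0; rewrite (@fubini_tonelli2 _ _ _ _ _ mu mu g' mg g0).
  rewrite (@fubini_tonelli2 _ _ _ _ _ mu mu (fun p => g' ((p.1 + a)%R, p.2)) (measurableT_comp mg mt)
    (fun p => g0 _)).
  apply: eq_integral => y _; rewrite /fubini_G /=.
  rewrite (@ge0_integral_translation _ a)//.
  exact: (measurable_fun_pair1 _ mg).
move=> mg; rewrite integralE [RHS]integralE; congr (_ - _)%E.
  have H := ge0 _ (measurable_funepos mg) (fun p => funepos_ge0 g p).
  by apply: (etrans H); apply: eq_integral => p _; rewrite !funeposE.
have H := ge0 _ (measurable_funeneg mg) (fun p => funeneg_ge0 g p).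
by apply: (etrans H); apply: eq_integral => p _; rewrite !funenegE.
Qed.

End petersson_product.

(** * Orthogonality relations *)

Section orthogonality.
Context {R : realType}.
Notation mu := (@lebesgue_measure R).
Notation mu2 := (mu \x mu)%E.
Notation plane := (measurableTypeR R * measurableTypeR R)%type.
Implicit Types (f h u v : R[i] -> R[i]) (p : R * R) (k : nat).
Local Notation Re := complex.Re.
Local Notation Im := complex.Im.

Lemma mulJ_sqnorm (z : R[i]) : z * z^* = (sqnorm z)%:C.
Proof. by rewrite -sqr_normc cabsE -rmorphXn /= cabs_sqnorm. Qed.

Lemma pet_diag k f p : pet k f f p = sqnorm (f (uhp_point p)) * p.2 ^+ k.
Proof. by rewrite /pet mulJ_sqnorm. Qed.

Lemma petDl k f u h p :
  pet k (fun t => f t + u t) h p = pet k f h p + pet k u h p.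
Proof. by rewrite /pet !mulrDl cReD mulrDl. Qed.

(* Translation by 1/2 maps it onto the right half, up to a null set. *)
Definition ford4_left : set (R * R) := ford4 `&` [set p | p.1 < 0].

Lemma measurable_ford4_slab (I : interval R) :
  measurable (ford4 `&` ([set` I] `*` setT) : set plane).
Proof.
apply: measurableI; first exact: measurable_ford4.
by apply: measurableX => //; exact: measurable_itv.
Qed.

Lemma ford4_leftE : ford4_left = ford4 `&` (`]-oo, 0[%classic `*` setT).
Proof.
by apply/seteqP; split => p /= [Dp]; rewrite /= in_itv /=; [move=> ?|case].
Qed.

(** A nonnegative integrand with zero integral vanishes off a null set; by continuity, u(p) <> 0
    would put a box of positive area inside that null set. *)
Lemma sqnorm_ae_eq0 k u p : holomorphic u ->
  (\int[mu2]_(q in ford4_left) (pet k u u q / q.2 ^+ 2)%:E = 0)%E ->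
  - (1 / 2) < p.1 -> p.1 < 0 -> 1 < p.2 -> u (uhp_point p) = 0.
Proof.
move=> hu I0 p1 p1' p2; apply/eqP; apply: contraT => u0.
have mD : measurable (ford4_left : set plane).
  by rewrite ford4_leftE; exact: measurable_ford4_slab.
have Hp : half_plane p by rewrite /half_plane /=; exact: lt_trans p2.
have mP : measurable_fun (ford4_left : set plane) (fun q : R * R => (pet k u u q / q.2 ^+ 2)%:E).
  apply: (@measurable_funS _ _ _ _ (half_plane : set plane)).
  - exact: (open_measurable_plane open_half_plane).
  - by move=> q [/ford4_half_plane].
  - exact: measurable_pet.
have [] : ae_eq mu2 ford4_left (fun q : R * R => (pet k u u q / q.2 ^+ 2)%:E) (cst 0%E).
  apply/(ae_eq_integral_abs _ mD mP).1; rewrite -[RHS]I0; apply: eq_integral => q.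
  rewrite inE => -[[q2 _ _] _]; rewrite gee0_abs// lee_fin divr_ge0 ?sqr_ge0//.
  by rewrite pet_diag mulr_ge0 ?addr_ge0 ?sqr_ge0// exprn_ge0// ltW.
move=> N [mN N0 subN].
have [e e0 eU] : exists2 e, 0 < e & ball p e `<=` [set q | pet k u u q != 0].
  have pp0 : pet k u u p != 0.
    by rewrite pet_diag mulf_neq0 ?expf_neq0 ?gt_eqF ?sqnorm_gt0.
  have o : nbhs (pet k u u p) [set x : R | x != 0].
    by apply: open_nbhs_nbhs; split; [exact: open_neq|exact: pp0].
  have /(_ _ o)/nbhs_ballP[e e0 eU] := pet_continuous (k := k) hu hu Hp.
  by exists e.
(* Small enough for the box to stay in the left half of the strip and above height 1, where the
   circle condition is automatic. *)
pose d := Num.min e (Num.min (- p.1) (Num.min (1 / 2 + p.1) (p.2 - 1))).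
have d0 : 0 < d by rewrite !lt_min e0 /=; apply/and3P; split; lra.
have [de dx dx' dy] : [/\ d <= e, d <= - p.1, d <= 1 / 2 + p.1 & d <= p.2 - 1].
  by rewrite /d !ge_min !lexx !orbT.
pose box : set plane := `]p.1 - d, p.1 + d[%classic `*` `]p.2 - d, p.2 + d[%classic.
have mbox : measurable box by apply: measurableX; exact: measurable_itv.
have boxN : box `<=` N.
  move=> q [/=]; rewrite !in_itv /= => /andP[q1 q2] /andP[q3 q4].
  apply: subN => /= H; have q20 : 1 < q.2 by lra.
  have qx : `|q.1| <= 1 / 2 by rewrite ler_norml; lra.
  have /H/eqP : ford4_left q.
    split; last by rewrite /=; lra.
    split=> //; first lra.
    have : 1 * 1 <= q.2 * q.2 by rewrite ler_pM// ltW.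
    have := sqr_ge0 q.1; rewrite (expr2 q.2); lra.
  rewrite eqe mulf_eq0 invr_eq0 expf_eq0 /= (gt_eqF (lt_trans ltr01 q20)) orbF.
  apply/negP; apply: eU; split; rewrite /ball /= ltr_distlC; apply/andP; split; lra.
have : (mu2 box <= mu2 N)%E by apply: le_measure; rewrite ?inE.
have muI (a : R) : mu (`]a - d, a + d[%classic : set R) = (2 * d)%:E.
  rewrite lebesgue_measure_itv /= lte_fin ifT; last by lra.
  by rewrite -EFinB; congr EFin; ring.
have -> : mu2 box = (2 * d * (2 * d))%:E.
  rewrite /box product_measure1E; [|exact: measurable_itv|exact: measurable_itv].
  by rewrite EFinM; congr (_ * _)%E; exact: muI.
by rewrite N0 lee_fin leNgt !mulr_gt0.
Qed.

Lemma translation_orthogonal k f1 f2 : ~~ odd k ->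
  holomorphic f1 -> holomorphic f2 -> cuspidal k f1 -> cuspidal k f2 ->
  (forall t, upper_half_plane t -> f1 (t + (2^-1 : R)%:C) = f2 t) ->
  (forall t, upper_half_plane t -> f2 (t + (2^-1 : R)%:C) = f1 t) ->
  Rintegral mu2 ford4
    (fun p : R * R => pet k f1 (fun t => f1 t + f2 t) p / p.2 ^+ 2) = 0 ->
  forall t, upper_half_plane t -> f1 t + f2 t = 0.
Proof.
have q1 : - (1 / 2) < - (1 / 4) :> R by lra.
have q2 : - (1 / 4) < 0 :> R by lra.
move=> ke h1 h2 c1 c2 f12 f21; set F := fun t => f1 t + f2 t => I0.
have hF : holomorphic F by exact: holomorphicD.
have cF : cuspidal k F by exact: cuspidalD.
have i1 := integrable_pet ke h1 hF c1 cF; have i2 := integrable_pet ke h2 hF c2 cF.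
pose w1 (p : R * R) := (pet k f1 F p / p.2 ^+ 2)%:E.
pose w2 (p : R * R) := (pet k f2 F p / p.2 ^+ 2)%:E.
have {}I0 : (\int[mu2]_(p in ford4) w1 p = 0)%E.
  by rewrite -[LHS]fineK ?(integrable_fin_num measurable_ford4 i1)// [fine _]I0.
have shift p : half_plane p -> w1 ((p.1 + 2^-1), p.2) = w2 p.
  move=> Hp; have -> : w1 (p.1 + 2^-1, p.2) = (pet k f1 F (p.1 + 2^-1, p.2) / p.2 ^+ 2)%:E by [].
  rewrite /w2 /pet (_ : uhp_point (p.1 + 2^-1, p.2) = uhp_point p + (2^-1 : R)%:C).
    by rewrite /F !f12// f21// addrC.
  by apply: complex_eqP => /=; rewrite ?addr0.
(* The domain is cut into x < 0, 0 <= x < 1/2 and the null edge x = 1/2; the second piece is exactly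
   the first one translated, up to the edge x = -1/2 included in the first. *)
have mL := measurable_ford4_slab `]-oo, 0[.
have mM := measurable_ford4_slab `[0, 1 / 2[.
have mN := measurable_ford4_slab `[1 / 2, +oo[.
set DL := ford4 `&` _ in mL; set DM := ford4 `&` _ in mM; set DN := ford4 `&` _ in mN.
have ford4E : ford4 = DL `|` (DM `|` DN).
  apply/seteqP; split => [p Dp|p [|[]] []//].
  rewrite /DL /DM /DN; have [x0|x0] := ltP p.1 0.
    by left; split=> //; split; rewrite //= in_itv.
  right; have [x1|x1] := ltP p.1 (1 / 2).
    by left; split=> //; split; rewrite //= in_itv /= x0.
  by right; split=> //; split; rewrite //= in_itv /= x1.
have mw1 : measurable_fun (ford4 : set plane) w1 by exact: measurable_int i1.
have N0 : (\int[mu2]_(p in DN) w1 p = 0)%E.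
  apply: null_set_integral => //.
    by apply: measurable_funS mw1 => //; [exact: measurable_ford4|move=> p []].
  apply/eqP; rewrite -measure_le0.
  apply: (@le_trans _ _ (mu2 ([set 1 / 2] `*` setT : set plane))).
    apply: le_measure; rewrite ?inE//; first by apply: measurableX.
    move=> p [[_ p1 _] [/=]]; rewrite in_itv /= andbT => p1' _.
    split=> //=; apply/eqP; rewrite eq_le p1' andbT.
    exact: le_trans (ler_norm _) p1.
  by rewrite product_measure1E//= lebesgue_measure_set1 mul0e.
have M_L : (\int[mu2]_(p in DM) w1 p = \int[mu2]_(p in DL) w2 p)%E.
  rewrite [LHS]integral_mkcond [RHS]integral_mkcond.
  rewrite (@integral_plane_translation _ 2^-1); last first.
    apply/(measurable_restrictT _ mM).
    by apply: measurable_funS mw1 => //; [exact: measurable_ford4|move=> p []].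
  apply: eq_integral => p _; rewrite !patchE.
  have ML : DM (p.1 + 2^-1, p.2) <-> DL p.
    rewrite /DM /DL /ford4 /= !in_itv /=; split.
      move=> [[y0 x1 xy] [/andP[x0 x2] _]]; rewrite ger0_norm// in x1 xy.
      have xneg : p.1 < 0 by lra.
      split; last by [].
      split=> //; rewrite ltr0_norm//; first lra.
      by move: xy; rewrite sqrrD; lra.
    move=> [[y0 x1 xy] [x0 _]]; rewrite ltr0_norm// in x1 xy.
    have x2 : 0 <= p.1 + 2^-1 by lra.
    split; last by split=> //; apply/andP; split => //; lra.
    split=> //; rewrite ger0_norm//; first lra.
    by rewrite sqrrD; lra.
  have [Lp|Lp] := pselect (DL p).
    rewrite mem_set ?mem_set//; last exact/ML.
    by apply: shift; case: Lp => /ford4_half_plane.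
  by rewrite memNset ?memNset// => /ML.
have iL (w : R * R -> \bar R) : mu2.-integrable (ford4 : set plane) w ->
    mu2.-integrable (DL : set plane) w.
  by move=> iw; apply: integrableS iw => //; [exact: measurable_ford4|move=> p []].
have L0 : (\int[mu2]_(p in DL) (w1 p + w2 p) = 0)%E.
  rewrite integralD//; [|exact: iL|exact: iL].
  rewrite -M_L -[RHS]I0 ford4E integral_setU//; last 3 first.
  - exact: measurableU.
  - by rewrite -ford4E.
  - apply/disj_setPS => p [[_ [/=]]]; rewrite in_itv /= => x0 _ [] [_ [/=]].
      by rewrite in_itv /= => /andP[]; rewrite leNgt x0.
    by rewrite in_itv /= andbT => x1; have := le_lt_trans x1 x0; rewrite ltNge divr_ge0.
  congr (_ + _)%E; rewrite integral_setU//; first by rewrite N0 adde0.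
  - by apply: measurable_funS mw1; [exact: measurable_ford4|rewrite ford4E; exact: subsetUr].
  - apply/disj_setPS => p [[_ [/=]]]; rewrite in_itv /= => /andP[_ x0] _ [_ [/=]].
    by rewrite in_itv /= andbT leNgt x0.
have vF := cuspidal_vanishes cF.
(* Any ray inside the left half of the strip would do; heights from 2 on exceed the bound 1 of
   [sqnorm_ae_eq0]. *)
apply: (vanishes_ray_eq0 (x0 := - (1 / 4)) (y1 := 2) vF) => y y0 y2.
apply: (@sqnorm_ae_eq0 k F (- (1 / 4), y) hF _ q1 q2 (lt_le_trans (ltr1n R 2) y2)).
rewrite ford4_leftE -/DL -[RHS]L0; apply: eq_integral => p _.
by rewrite /w1 /w2 -EFinD -mulrDl -petDl.
Qed.

End orthogonality.

(** * The Fricke involution and the half translation at level 4 *)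

Section fricke_level4.
Context {R : realType}.
Notation mu := (@lebesgue_measure R).
Notation mu2 := (mu \x mu)%E.
Notation plane := (measurableTypeR R * measurableTypeR R)%type.
Implicit Types (f h u v g : R[i] -> R[i]) (p : R * R) (k : nat).
Local Notation Re := complex.Re.
Local Notation Im := complex.Im.
Local Notation W := (real_mx R (fricke 4)).

(** The nonnegative case applies to the positive and the negative part separately; written as (|G| +
    G) / 2 and (|G| - G) / 2, they inherit continuity from G. *)
Lemma integral_ford4_inversion_signed (G : R * R -> R) :
  (forall p, half_plane p -> continuous_at p G) ->
  Rintegral mu2 ford4 (fun p : R * R => G p / p.2 ^+ 2) =
  Rintegral mu2 ford4 (fun p : R * R => G (inversion p) / p.2 ^+ 2).
Proof.
move=> cG; congr fine; rewrite integralE [RHS]integralE.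
pose Gp p := (`|G p| + G p) / 2; pose Gn p := (`|G p| - G p) / 2.
have posE (x y : R) : Num.max (x / y ^+ 2) 0 = (`|x| + x) / 2 / y ^+ 2.
  have [x0|x0] := leP 0 x.
    rewrite ger0_norm// max_l ?divr_ge0 ?sqr_ge0//.
    by have -> : (x + x) / 2 = x by field.
  rewrite ltr0_norm// addNr !mul0r max_r//.
  by rewrite mulr_le0_ge0 ?invr_ge0 ?sqr_ge0// ltW.
have negE (x y : R) : Num.max (- (x / y ^+ 2)) 0 = (`|x| - x) / 2 / y ^+ 2.
  by rewrite -mulNr posE normrN.
have cGp p : half_plane p -> continuous_at p Gp.
  move=> Hp; apply: cts_mul; last exact: cts_cst.
  by apply: cts_add; [apply: cts_norm|]; exact: cG.
have cGn p : half_plane p -> continuous_at p Gn.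
  move=> Hp; apply: cts_mul; last exact: cts_cst.
  by apply: cts_sub; [apply: cts_norm|]; exact: cG.
have Gp0 p : 0 <= Gp p.
  by rewrite divr_ge0// -lerBlDr sub0r -normrN ler_norm.
have Gn0 p : 0 <= Gn p.
  by rewrite divr_ge0// subr_ge0 ler_norm.
congr (_ - _)%E.
  transitivity (\int[mu2]_(p in ford4) (Gp p / p.2 ^+ 2)%:E)%E.
    by apply: eq_integral => p _; rewrite funeposE -EFin_max posE.
  rewrite integral_ford4_inversion//.
  by apply: eq_integral => p _; rewrite funeposE -EFin_max posE.
transitivity (\int[mu2]_(p in ford4) (Gn p / p.2 ^+ 2)%:E)%E.
  by apply: eq_integral => p _; rewrite funenegE -EFinN -EFin_max negE.
rewrite integral_ford4_inversion//.
by apply: eq_integral => p _; rewrite funenegE -EFinN -EFin_max negE.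
Qed.

Lemma det_W : \det W = 4 :> R.
Proof. by rewrite det_real_mx det_fricke. Qed.

Lemma det_W_gt0 : 0 < \det W.
Proof. by rewrite det_W. Qed.

Lemma W4E : W4 R = W.
Proof.
by rewrite /W4 /fricke real_mx2; apply: matrix2P; rewrite !mx2E.
Qed.

Lemma pet_slash_fricke k f h p : ~~ odd k -> half_plane p ->
  pet k (slash k W f) (slash k W h) p = pet k f h (inversion p).
Proof.
move=> ke Hp; have Ht : upper_half_plane (uhp_point p) by [].
have a0 := automorphy_factor_neq0 (lt0r_neq0 det_W_gt0) Ht.
have s0 := sqnorm_gt0 a0.
have aE : sqnorm (automorphy_factor W (uhp_point p)) = 4 * (4 * (p.1 ^+ 2 + p.2 ^+ 2)).
  rewrite /automorphy_factor real_mx2 !mx2E /sqnorm cReD cImD cReMC cImMC /=.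
  by rewrite (_ : 4%:Z%:~R = 4 :> R)//; ring.
have n0 : p.1 ^+ 2 + p.2 ^+ 2 != 0 by rewrite gt_eqF// ltr_wpDl ?sqr_ge0 ?exprn_gt0.
have mE : moebius W (uhp_point p) = uhp_point (inversion p).
  apply: complex_eqP; last first.
    by rewrite Im_moebius// det_W aE /inversion /=; field.
  rewrite /moebius cReM cReV cImV aE /automorphy_factor real_mx2 !mx2E.
  rewrite /inversion !cReD !cImD !cReMC !cImMC /= (_ : 4%:Z%:~R = 4 :> R)//.
  by rewrite rmorphN /=; field.
rewrite /pet /slash mE; set A := _ * _ ^- k; set z := f _; set w := h _.
have -> : A * z * (A * w)^* = (sqnorm A)%:C * (z * w^*).
  by rewrite rmorphM -mulJ_sqnorm /=; ring.
rewrite cReMC mulrAC mulrC; congr (_ * _).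
have -> : sqnorm A * p.2 ^+ k = (cabs A * Im (uhp_point p) ^+ k./2) ^+ 2.
  rewrite exprMn cabs_sqnorm -exprM muln2 (_ : k./2.*2 = k)//.
  by rewrite -[RHS]odd_double_half (negbTE ke).
(* Applied to the constant function 1, [cabs_slash] isolates the modulus of the factor [A]. *)
have := @cabs_slash _ k W (fun=> 1) (uhp_point p) ke det_W_gt0 Ht.
rewrite mE /slash mulr1 -/A => ->.
rewrite (_ : cabs 1 = 1) ?mul1r; last by rewrite (@cabs_real _ 1).
rewrite -exprM muln2 (_ : k./2.*2 = k)//.
by rewrite -[RHS]odd_double_half (negbTE ke).
Qed.

(** Twice the matrix of the translation by 1/2: integral, so that [cuspidal_slash] applies, and with
    the same action for even k. *)
Definition half_shift : 'M[int]_2 := mx2 2 1 0 2.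
Local Notation T := (real_mx R half_shift).
Local Notation r := (real_mx R trace_rep).

Lemma det_T_gt0 : 0 < \det T.
Proof. by rewrite det_real_mx_gt0 det_mx2 !mx2E. Qed.

Lemma det_r_gt0 : 0 < \det r.
Proof. by rewrite det_real_mx_gt0 det_trace_rep. Qed.

Lemma slash_half_shift k f t : ~~ odd k ->
  slash k T f t = f (t + (2^-1 : R)%:C).
Proof.
move=> ke; have -> : T = 2 *: mx2 1 2^-1 0 1.
  rewrite /half_shift real_mx2; apply: matrix2P; rewrite !mxE /=.
  - by rewrite mulr1.
  - by rewrite divff.
  - by rewrite mulr0.
  - by rewrite mulr1.
rewrite slashZ//; last by rewrite det_mx2 !mx2E mulr0 subr0 mulr1.
rewrite /slash det_mx2 !mx2E mulr0 subr0 mulr1 powR1 mul1r.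
rewrite /moebius /automorphy_factor !mx2E !mul0r !add0r !mul1r.
by rewrite expr1n !invr1 mul1r mulr1.
Qed.

(** Two half translations make the translation by 1, which lies in Gamma_0(4); hence g and g|T are
    exchanged, as [translation_orthogonal] asks. *)
Lemma slash_half_shift_opp k g : ~~ odd k -> cusp_form 4 k g ->
  Rintegral mu2 ford4 (fun p : R * R =>
    pet k g (fun t => g t + slash k T g t) p / p.2 ^+ 2) = 0 ->
  forall t, upper_half_plane t -> slash k T g t = - g t.
Proof.
move=> ke cg I0 t Ht; have [hg _ cusp] := cg.
have dT : 0 < \det half_shift by rewrite det_mx2 !mx2E.
have Hs s : upper_half_plane s -> upper_half_plane (s + (2^-1 : R)%:C).
  by rewrite /upper_half_plane /= cImD /= addr0.
apply/eqP; rewrite -addr_eq0 addrC; apply/eqP.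
apply: (@translation_orthogonal _ k g (slash k T g) ke hg _ cusp _ _ _ I0 t Ht).
- exact: (@holomorphic_slash _ k T g det_T_gt0 hg).
- exact: (cuspidal_slash dT cusp).
- by move=> s Hs'; rewrite slash_half_shift.
- move=> s Hs'; rewrite slash_half_shift//.
  have hA : Gamma0 4 (mx2 1 1 0 1).
    by split; rewrite ?mx2E// /SL2Z /= det_mx2 !mx2E.
  rewrite -[RHS](cusp_form_slash cg hA Hs') real_mx2 /slash /moebius.
  rewrite /automorphy_factor det_mx2 !mx2E mulr0 subr0 mulr1 powR1 !mul0r !add0r !mul1r.
  rewrite expr1n !invr1 mul1r mulr1 -addrA -rmorphD /=; congr (g (_ + _%:C)).
  by field.
Qed.

End fricke_level4.

Theorem theorem1p3 (R : realType) (k : nat) (k_gt0 : (0 < k)%N)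
    (k_even : ~~ odd k) (g : R[i] -> R[i]) (g_new : new_space 4 k g) :
  forall tau : R[i], upper_half_plane tau ->
    slash k (W4 R) g tau = - g tau.
Proof.
have [cg orth] := g_new; rewrite W4E.
set W := real_mx R (fricke 4); set T := real_mx R half_shift.
set r := real_mx R trace_rep.
have dW : 0 < \det W := det_W_gt0; have dT : 0 < \det T := det_T_gt0.
have dr : 0 < \det r := det_r_gt0.
pose g' := slash k W g; have cg' : cusp_form 4 k g' by exact: cusp_form_fricke.
have gWW t : upper_half_plane t -> slash k W g' t = g t.
  move=> Ht; rewrite /g' slashM//.
  have -> : W *m W = (-4) *: 1%:M.
    by rewrite /W /fricke real_mx2; apply: matrix2P; rewrite mulmx2 !mx2E !mxE /=; ring.
  by rewrite slashZ ?slash1 ?det1// oppr_eq0 pnatr_eq0.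
(* g + g|T = c H(2 tau), where H is the image under the Fricke involution of
   level 2 of the trace of g' *)
have gT t : upper_half_plane t -> slash k T g t = - g t.
  apply: (slash_half_shift_opp k_even cg).
  pose P t := g' t + slash k r g' t.
  have cP : cusp_form 2 k P by exact: cusp_form_trace.
  pose H := slash k (real_mx R (fricke 2)) P.
  have cH : cusp_form 2 k H by exact: cusp_form_fricke.
  have old : old_space 4 k (fun t => g t + slash k T g t).
    exists 1%N, (fun=> (2 `^ (k%:R / 2) : R)%:C), (fun=> (fun t => H (2%:R * t))).
    clear t; split=> [_|t Ht]; first by exists 2%N, 2%N, H; split; [| | |exact: cH|].
    rewrite big_ord1.
    have dD : 0 < \det (mx2 2 0 0 1 : 'M[R]_2) by rewrite det_mx2 !mx2E mulr1 mulr0 subr0.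
    have d2 : 0 < \det (real_mx R (fricke 2)) by rewrite det_real_mx_gt0 det_fricke.
    transitivity (slash k (mx2 2 0 0 1) H t); last first.
      rewrite /slash det_mx2 /moebius /automorphy_factor !mx2E mulr1 mulr0 subr0.
      by rewrite mul0r add0r expr1n invr1 addr0 !mulr1 rmorph_nat.
    (* W_2 diag(2, 1) = W_4, whence the constant 2^(k/2) above; the old form is therefore the trace
       of g' slashed by W_4. The second summand becomes g|T because W r W = -2 T. *)
    rewrite /H slashM// (_ : _ *m _ = W); last first.
      by rewrite /W /fricke !real_mx2; apply: matrix2P; rewrite mulmx2 !mx2E /=; ring.
    rewrite slashD gWW//; congr (_ + _); rewrite slashM// slashM ?det_mulmx ?mulr_gt0//.
    rewrite (_ : W *m (r *m W) = (-2) *: T); last first.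
      rewrite /W /r /T /fricke /trace_rep /half_shift !real_mx2.
      by apply: matrix2P; rewrite !mulmx2 !mx2E !mxE /=; ring.
    by rewrite slashZ// oppr_eq0 pnatr_eq0.
  by rewrite -Re_petersson (orth _ old).
have g'T t : upper_half_plane t -> slash k T g' t = - g' t.
  apply: (slash_half_shift_opp k_even cg').
  pose P t := g t + slash k r g t.
  have cP : cusp_form 2 k P by exact: cusp_form_trace.
  have old : old_space 4 k P.
    exists 1%N, (fun=> 1), (fun=> (fun t => P (1%:R * t))).
    clear t; split=> [_|t Ht]; first by exists 2%N, 1%N, P; split; [| | |exact: cP|].
    by rewrite big_ord1 !mul1r.
  have hg := let: And3 hg _ _ := cg in hg.
  have hP := let: And3 hP _ _ := cP in hP.
  (* The relation <g, P> = 0 is carried by W_4 to <g', P|W_4> = 0, and P|W_4 = g' + g'|T because 2 r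
     W = W T. *)
  have gP0 := Re_petersson k g P; rewrite (orth _ old) in gP0.
  rewrite -[RHS]/(complex.Re (0 : R[i])) gP0 (@integral_ford4_inversion_signed R (pet k g P)); last first.
    by move=> p Hp; exact: (pet_continuous hg hP Hp).
  apply: eq_Rintegral => p; rewrite inE => /ford4_half_plane Hp; congr (_ / _).
  rewrite -pet_slash_fricke// /pet; congr (complex.Re (_ * _^*) * _).
  rewrite slashD; congr (_ + _); rewrite /g' !slashM//.
  rewrite -(@slashZ _ k (r *m W) 2) ?det_mulmx ?mulr_gt0 ?pnatr_eq0//.
  rewrite (_ : 2 *: (r *m W) = W *m T)//.
  rewrite /W /r /T /fricke /trace_rep /half_shift !real_mx2.
  by apply: matrix2P; rewrite [LHS]mxE !mulmx2 !mx2E /=; ring.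
have slashN M f t : slash k M (fun s => - f s) t = - slash k M f t.
  by rewrite /slash mulrN.
move=> tau Htau.
(* (W T)^3 is scalar, so g = g|WTWTWT; the six steps bring the signs. *)
have e1 t : upper_half_plane t -> slash k W (slash k T g') t = - g t.
  by move=> Ht; rewrite (slash_eq k dW g'T)// slashN gWW.
have e2 t : upper_half_plane t -> slash k T (slash k W (slash k T g')) t = g t.
  by move=> Ht; rewrite (slash_eq k dT e1)// slashN gT// opprK.
have e3 : slash k T (slash k W (slash k T (slash k W (slash k T g')))) tau = - g' tau.
  rewrite -g'T//; apply: slash_eq => // t Ht; exact: slash_eq.
suff gE : g tau = - g' tau by rewrite gE opprK.
rewrite -e3.
rewrite /g' !slashM ?det_mulmx ?mulr_gt0//.
rewrite (_ : _ *m _ = (-64) *: 1%:M); last first.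
  rewrite /W /T /fricke /half_shift !real_mx2.
  by apply: matrix2P; rewrite !mulmx2 !mx2E !mxE /=; ring.
by rewrite slashZ ?slash1 ?det1// oppr_eq0 pnatr_eq0.
Qed.
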